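(* Let $(\Omega,\mathcal F,\mu,\{\mathcal F_n\}_{n\ge 0})$ be a filtered probability space. Let $1<p\le2\le p'\le r<\infty$, where $p'=p/(p-1)$, let $w$ be a weight, $\sigma=w^{-\frac1{p-1}}\in L^1$, with $\sigma\in(A_{p'})^{\frac1{p'-1}}(A_r)^{1-\frac1{p'-1}}$, and let $S$ be a sparse operator with sparsity constant $K$. Then for every $f\in L^p(w)$, $$\|S|f|\|_{L^p(w)}\le C\,[\sigma]_{(A_{p'})^{\frac1{p'-1}}(A_r)^{1-\frac1{p'-1}}}\,\|f\|_{L^p(w)},$$ where $C$ depends only on $p,r$ and $K$ (not on $w$ or $f$).
   Context: Filtered probability space: $(\Omega,\mathcal F,\mu)$ is a complete probability space, $\{\mathcal F_n\}_{n\ge0}$ is an increasing sequence of sub-$\sigma$-algebras of $\mathcal F$, each $(\Omega,\mathcal F_n,\mu)$ is complete, and $\mathcal F$ is the $\sigma$-algebra generated by $\bigcup_n\mathcal F_n$. Weights: a weight is a positive random variable in $L^1(\mu)$; $\|f\|_{L^p(w)}=(\int_\Omega|f|^pw\,d\mu)^{1/p}$. Write $g_n=\mathbb E(g\mid\mathcal F_n)$. For a weight $\rho$ and $1<q<\infty$ with $\rho^{-1/(q-1)}\in L^1$, put $A_{n,q}(\rho)=\big\|\rho_n\,\big((\rho^{-1/(q-1)})_n\big)^{q-1}\big\|_\infty$. For $\alpha,\beta\ge0$ and exponents $q\le r$, $[\rho]_{(A_q)^\alpha(A_r)^\beta}=\sup_{n\ge0}A_{n,q}(\rho)^\alpha A_{n,r}(\rho)^\beta$,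 and $\rho\in(A_q)^\alpha(A_r)^\beta$ means this quantity is finite. Stopping times: $\tau:\Omega\to\{0,1,2,\dots\}\cup\{\infty\}$ with $\{\tau=n\}\in\mathcal F_n$ for all $n$; $\mathcal F_\tau=\{F\in\mathcal F: F\cap\{\tau\le n\}\in\mathcal F_n\ \forall n\}$. Local space induced by a stopping time $\tau$: if $\mu(\tau<\infty)>0$, it is $(\widetilde\Omega,\widetilde{\mathcal F},\widetilde\mu,\{\widetilde{\mathcal F}_n\})$ with $\widetilde\Omega=\{\tau<\infty\}$, $\widetilde{\mathcal F}=\mathcal F|_{\{\tau<\infty\}}$, $\widetilde{\mathcal F}_n=\mathcal F_{\tau+n}|_{\{\tau<\infty\}}$, $\widetilde\mu=\mu|_{\{\tau<\infty\}}/\mu(\tau<\infty)$; any stopping time on this local space is called a locally filter-shifted stopping time relative to $\tau$. If $\mu(\tau<\infty)=0$, the local space is the space on which $\tau$ is defined, and $\tau$ itself is the only locally filter-shifted stopping time relative to $\tau$. Conditional sparsity: let $(\Omega^{(0)},\mathcal F^{(0)},\mu^{(0)},\{\mathcal F^{(0)}_n\})=(\Omega,\mathcal F,\mu,\{\mathcal F_n\})$, $\tau^{(0)}=0$, and for $i\ge0$ let $(\Omega^{(i+1)},\mathcal F^{(i+1)},\mu^{(i+1)},\{\mathcal F^{(i+1)}_n\})$ be the local space induced by the stopping time $\tau^{(i)}$ of $(\Omega^{(i)},\mathcal F^{(i)},\mu^{(i)},\{\mathcal F^{(i)}_n\})$, and $\tau^{(i+1)}$ a locally filter-shifted stopping time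 relative to $\tau^{(i)}$. Put $E_i=\{\tau^{(i)}<\infty\}$ and $S_i=E_i\setminus E_{i+1}$. The sequence $\{\tau^{(i)}\}_{i\ge0}$ is conditionally sparse if there is a constant $K\ge1$ (the sparsity constant) with $$\mathbf 1_{E_i}\le K\,\mathbb E\big(\mathbf 1_{S_i}\mid\mathcal F^{(i)}_{\tau^{(i)}}\big)\mathbf 1_{E_i}\qquad\text{for all } i\ge0 .$$ Conditional expectations given $\mathcal F^{(i)}_{\tau^{(i)}}$ are taken on $(\Omega^{(i)},\mathcal F^{(i)},\mu^{(i)})$, and their products with $\mathbf 1_{E_i}$ are extended by $0$ to $\Omega$. Sparse operator: an operator of the form $S|f|=\sum_{i=0}^\infty \mathbb E\big(|f|\mid\mathcal F^{(i)}_{\tau^{(i)}}\big)\mathbf 1_{E_i}$, $f\in L^1$, where $\{\tau^{(i)}\}_{i\ge0}$ is conditionally sparse. *)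

(* Defs.v *)
From HB Require Import structures.
From mathcomp Require Import all_boot all_order all_algebra.
From mathcomp Require Import all_classical all_reals all_analysis.

Set Implicit Arguments.
Unset Strict Implicit.
Unset Printing Implicit Defensive.
Import Order.TTheory GRing.Theory Num.Theory.
Import numFieldNormedType.Exports.

Local Open Scope classical_set_scope.
Local Open Scope ring_scope.

Section FilteredSpaces.
Context {d : measure_display} {T : measurableType d} {R : realType}.

Definition filtered_probability_space
    (P : probability T R) (F : nat -> set (set T)) : Prop :=
  [/\ measure_is_complete P,
      forall n, sigma_algebra setT (F n) /\ F n `<=` measurable,
      forall m n, (m <= n)%N -> F m `<=` F n,
      forall n (A B : set T), F n A -> P A = 0%E -> B `<=` A -> F n B &
      measurable = <<s \bigcup_n F n >> ].

(* All the local spaces live on measurable subsets of the fixed type T: the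
   underlying set is [carrier], the members of [events] and of [filt n] are
   subsets of it, and [prob] is a set function on T concentrated on it. *)
Record fspace := FSpace {
  carrier : set T;
  events : set (set T);
  prob : set T -> \bar R;
  filt : nat -> set (set T) }.

Definition base_space (P : probability T R) (F : nat -> set (set T)) : fspace :=
  FSpace setT measurable P F.

(* Random times take values in [option nat], [None] being infinity; only their
   values on the carrier of the space under consideration are relevant. *)
Definition time := T -> option nat.

Definition time_shift (t : time) (n : nat) : time :=
  fun x => omap (fun k => (k + n)%N) (t x).

Definition t_eq (X : fspace) (t : time) (n : nat) : set T :=
  carrier X `&` [set x | t x = Some n].

Definition t_le (X : fspace) (t : time) (n : nat) : set T :=
  carrier X `&` [set x | exists2 k, t x = Some k & (k <= n)%N].

Definition t_fin (X : fspace) (t : time) : set T :=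
  carrier X `&` [set x | t x <> None].

Definition stopping_time (X : fspace) (t : time) : Prop :=
  forall n, filt X n (t_eq X t n).

Definition stopped_sigma (X : fspace) (t : time) : set (set T) :=
  [set A | events X A /\ forall n, filt X n (A `&` t_le X t n)].

Definition local_space (X : fspace) (t : time) : fspace :=
  let E := t_fin X t in
  if (0 < prob X E)%E then
    FSpace E
      (strace (events X) E)
      (fun A => (prob X (A `&` E) * (fine (prob X E))^-1%:E)%E)
      (fun n => strace (stopped_sigma X (time_shift t n)) E)
  else X.

Definition filter_shifted (X : fspace) (t t' : time) : Prop :=
  if (0 < prob X (t_fin X t))%E then stopping_time (local_space X t) t'
  else forall x, carrier X x -> t' x = t x.

Definition is_cond_exp (X : fspace) (G : set (set T)) (f g : T -> R) : Prop :=
  [/\ forall B : set R, measurable B -> G (carrier X `&` g @^-1` B),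
      (prob X).-integrable (carrier X) (EFin \o g) &
      forall A, G A ->
        (\int[prob X]_(x in A) (g x)%:E = \int[prob X]_(x in A) (f x)%:E)%E ].

(* A chosen version of E(f | G), which exists for f integrable on X and G a
   sub-sigma-algebra of [events X]; the default value 0 is otherwise junk. *)
Definition cond_exp (X : fspace) (G : set (set T)) (f : T -> R) : T -> R :=
  xget (fun=> 0) [set g | is_cond_exp X G f g].

Definition weight (P : probability T R) (w : T -> R) : Prop :=
  (forall x, 0 < w x) /\ P.-integrable setT (EFin \o w).

Definition wnorm (P : probability T R) (p : R) (w : T -> R)
    (f : T -> \bar R) : \bar R :=
  ((\int[P]_x (`|f x| `^ p * (w x)%:E)) `^ p^-1)%E.

Definition in_wLp (P : probability T R) (p : R) (w : T -> R)
    (f : T -> R) : Prop :=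
  measurable_fun setT f /\ (wnorm P p w (EFin \o f) < +oo)%E.

Section Muckenhoupt.
Variables (P : probability T R) (F : nat -> set (set T)).

Definition Eat (n : nat) (g : T -> R) : T -> R :=
  cond_exp (base_space P F) (F n) g.

Definition Aconst (n : nat) (q : R) (rho : T -> R) : \bar R :=
  Lnorm P +oo%E (fun x =>
    (Eat n rho x * (Eat n (fun y => rho y `^ (- (q - 1)^-1)) x) `^ (q - 1))%:E).

Definition mixedA (q a r b : R) (rho : T -> R) : \bar R :=
  ereal_sup (range (fun n =>
    (Aconst n q rho `^ a * Aconst n r rho `^ b)%E)).

End Muckenhoupt.

Section Sparse.
Variables (P : probability T R) (F : nat -> set (set T)) (tau : nat -> time).

Fixpoint spaces (i : nat) : fspace :=
  if i is j.+1 then local_space (spaces j) (tau j) else base_space P F.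

Definition local_times : Prop :=
  (forall x, tau 0%N x = Some 0%N) /\
  forall i, filter_shifted (spaces i) (tau i) (tau i.+1).

Definition Eset (i : nat) : set T := t_fin (spaces i) (tau i).

Definition Sset (i : nat) : set T := Eset i `\` Eset i.+1.

Definition Estop (i : nat) (g : T -> R) : T -> R :=
  cond_exp (spaces i) (stopped_sigma (spaces i) (tau i)) g.

Definition conditionally_sparse (K : R) : Prop :=
  [/\ 1 <= K, local_times &
      forall i, {ae P, forall x,
        \1_(Eset i) x <= K * Estop i (\1_(Sset i)) x * \1_(Eset i) x} ].

Definition sparse_op (f : T -> R) : T -> \bar R :=
  fun x => (\sum_(0 <= i <oo)
    (Estop i (fun y => `|f y|%R) x * \1_(Eset i) x)%:E)%E.

End Sparse.

End FilteredSpaces.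

(* Main.v *)
Require Import Defs.
From HB Require Import structures.
From mathcomp Require Import all_boot all_order all_algebra.
From mathcomp Require Import all_classical all_reals all_analysis.
From mathcomp Require Import measurable_realfun ess_sup_inf ring lra.

Set Implicit Arguments.
Unset Strict Implicit.
Unset Printing Implicit Defensive.
Import Order.TTheory GRing.Theory Num.Theory.
Import numFieldNormedType.Exports.

Local Open Scope classical_set_scope.
Local Open Scope ring_scope.

(** The base space restricted to [{tau_0 + ... + tau_(i-1) < oo}] and shifted by
    this total time is the i-th local space, so on the set [D_(i,n)] where the
    i-th total time equals [n] the conditional expectation of the sparse operator
    is the ordinary E(. | F_n).

    Put h = |f|, q = p', u = sigma^(-1/(r-1)), kappa = (r-1)(2-p), and let a, b, c
    be the conditional expectations of w, sigma, u given F_n; the mixed constant M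
    bounds a b c^kappa.  Testing against psi w, each level contributes
      int_D E(h|F_n) E(psi w|F_n) = int_D x y a b <= M int_D x y c^(-kappa),
    with x = E(psi w|F_n)/a and y = E(h|F_n)/b.  By the sparsity condition and the
    conditional Chebyshev inequality, the part of [D] that lies in S_i and in
    [{u < 2 K c}] carries a fraction 1/(2K) of the mass, and there
    c^(-kappa) <= (2K)^kappa sigma^(2-p) = (2K)^kappa w^(1/q) sigma^(1/p).  The sets
    [D_(i,n)] meet S_i in pairwise disjoint sets, so x and y may be replaced by
    Doob maximal functions for the measures w dP and sigma dP, and Hoelder's
    inequality concludes; psi is the (p-1)-th power of the truncated operator. *)

(** * Integrals and sub-sigma-algebras *)

(** The bound [a b c^kappa <= M] rests on the exponents [p - 1] and [2 - p] of the two constants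
    adding up to 1: the product of [(b a^(q-1))^(p-1)] and [(b c^(r-1))^(2-p)] contains [b] exactly
    once. The leftover [c^kappa] is an average, while Hoelder needs a function of the point. The
    lower bound for the mass of S_i does not provide one, so the part where [u >= 2 K c] has to be
    discarded. As psi is built from the operator itself, the last inequality has the same integral
    on both sides; cancelling it requires finiteness, hence the truncation. The factor [p q] is the
    product of the Doob constants for exponent [q] with [w] and exponent [p] with [sigma].

    Two degenerate cases shape the formal argument. A chosen local conditional expectation may be
    the default 0, so it is used only through nonnegativity and an upper bound. A stage of
    probability zero freezes the space and the time, so it is confined to a null set. *)

Section IntegralFacts.
Context {d : measure_display} {T : measurableType d} {R : realType}.
Variable mu : {measure set T -> \bar R}.

Lemma integral_in_indic (A : set T) (f : T -> R) :
  (\int[mu]_(x in A) (f x)%:E = \int[mu]_x (\1_A x * f x)%:E)%E.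
Proof.
rewrite integral_mkcond; apply: eq_integral => x _.
by rewrite patchE indicE; case: ifP => xA; rewrite ?mul1r ?mul0r.
Qed.

Lemma ge0_le_integral_EFin (f g : T -> R) :
  measurable_fun setT f -> measurable_fun setT g ->
  (forall x, 0 <= f x) -> (forall x, f x <= g x) ->
  (\int[mu]_x (f x)%:E <= \int[mu]_x (g x)%:E)%E.
Proof.
move=> mf mg f0 fg; apply: ge0_le_integral => //.
- by move=> x _; rewrite lee_fin.
- exact/measurable_EFinP.
- exact/measurable_EFinP.
- by move=> x _; rewrite lee_fin.
Qed.

Lemma ae_ge0_le_integral_EFin (f g : T -> R) :
  measurable_fun setT f -> measurable_fun setT g ->
  (forall x, 0 <= f x) -> (forall x, 0 <= g x) ->
  {ae mu, forall x, f x <= g x} ->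
  (\int[mu]_x (f x)%:E <= \int[mu]_x (g x)%:E)%E.
Proof.
move=> mf mg f0 g0 fg; apply: ae_ge0_le_integral => //.
- by move=> x _; rewrite lee_fin.
- exact/measurable_EFinP.
- by move=> x _; rewrite lee_fin.
- exact/measurable_EFinP.
- by apply: filterS fg => x ? _; rewrite lee_fin.
Qed.

Lemma ge0_integralZl_real (k : R) (f : T -> R) :
  measurable_fun setT f -> (forall x, 0 <= f x) -> 0 <= k ->
  (\int[mu]_x (k * f x)%:E = k%:E * \int[mu]_x (f x)%:E)%E.
Proof.
move=> mf f0 k0; under eq_integral do rewrite EFinM.
rewrite ge0_integralZl_EFin// => [x _|]; first by rewrite lee_fin.
exact/measurable_EFinP.
Qed.

Lemma ge0_integralD_real (f g : T -> R) :
  measurable_fun setT f -> (forall x, 0 <= f x) ->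
  measurable_fun setT g -> (forall x, 0 <= g x) ->
  (\int[mu]_x (f x + g x)%:E = \int[mu]_x (f x)%:E + \int[mu]_x (g x)%:E)%E.
Proof.
move=> mf f0 mg g0; under eq_integral do rewrite EFinD.
rewrite ge0_integralD//.
- by move=> x _; rewrite lee_fin.
- exact/measurable_EFinP.
- by move=> x _; rewrite lee_fin.
- exact/measurable_EFinP.
Qed.

Lemma ge0_integral_sum_real (I : Type) (s : seq I) (f : I -> T -> R) :
  (forall i, measurable_fun setT (f i)) -> (forall i x, 0 <= f i x) ->
  (\int[mu]_x (\sum_(i <- s) f i x)%:E = \sum_(i <- s) \int[mu]_x (f i x)%:E)%E.
Proof.
move=> mf f0; under eq_integral do rewrite -sumEFin.
rewrite ge0_integral_sum//.
- by move=> i; exact/measurable_EFinP.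
- by move=> i x _; rewrite lee_fin.
Qed.

(* The exceptional null set is absorbed by making the upper function +oo there. *)
Lemma ae_le_ge0_integral (f g : T -> \bar R) :
  (forall x, (0 <= f x)%E) -> (forall x, (0 <= g x)%E) ->
  measurable_fun setT g -> {ae mu, forall x, (f x <= g x)%E} ->
  (\int[mu]_x f x <= \int[mu]_x g x)%E.
Proof.
move=> f0 g0 mg [N [mN N0 fgN]].
pose h := fun x => (if x \in N then +oo else g x)%E.
have mh : measurable_fun setT h.
  apply: measurable_fun_if => //.
  - apply: (measurable_fun_bool true).
    rewrite setTI; have -> : (fun x => x \in N) @^-1` [set true] = N => //.
    by apply/seteqP; split => x /=; [move/set_mem|move/mem_set].
  - exact: measurable_funS mg.
have h0 x : (0 <= h x)%E by rewrite /h; case: ifP.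
have -> : (\int[mu]_x g x = \int[mu]_x h x)%E.
  apply: ge0_ae_eq_integral => //.
  exists N; split => // x /= gh; apply: contrapT => xN.
  by apply: gh => _; rewrite /h memNset.
(* [f] carries no measurability, so the comparison is made on the simple functions below [f] in the
   definition of the integral. *)
rewrite ge0_integralTE// ge0_integralTE//.
apply: le_ereal_sup => _ [k kf <-]; exists k => // x.
rewrite /h; case: ifPn => [_|xN]; first exact: leey.
apply: (le_trans (kf x)); apply: contrapT => fg; move/negP: xN; apply.
by apply/mem_set/fgN.
Qed.

End IntegralFacts.

(** * Sub-sigma-algebras and existence of conditional expectations *)

Section SubSigmaAlgebra.
Context {d : measure_display} {T : measurableType d} {R : realType}.
Variable G : set (set T).
Hypothesis sG : sigma_algebra setT G.
Hypothesis Gm : G `<=` measurable.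

Local Notation TG := (g_sigma_algebraType G).

(** A sigma-algebra generates only itself, so measurability on [TG] is exactly [G]-measurability;
    conditional statements are phrased in this way throughout. *)
Lemma sub_measurableE (A : set TG) : measurable A <-> G A.
Proof. by rewrite /measurable/= sigma_algebra_id. Qed.

Lemma sub_measurable_fun d' (U : measurableType d') (f : TG -> U) :
  measurable_fun setT f -> measurable_fun (setT : set T) (f : T -> U).
Proof.
by move=> mf _ B mB; apply: Gm; apply/sub_measurableE; exact: mf.
Qed.

Import HBNNSimple.

Lemma le_integral_nnsfunM (mu : {measure set T -> \bar R}) (h : {nnsfun TG >-> R})
    (f g : T -> R) :
  measurable_fun setT f -> measurable_fun setT g ->
  (forall x, 0 <= f x) -> (forall x, 0 <= g x) ->
  (forall A, G A -> \int[mu]_(x in A) (f x)%:E <= \int[mu]_(x in A) (g x)%:E)%E ->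
  (\int[mu]_x (h x * f x)%:E <= \int[mu]_x (h x * g x)%:E)%E.
Proof.
move=> mf mg f0 g0 fg.
have E (k : T -> R) : measurable_fun setT k -> (forall x, 0 <= k x) ->
    (\int[mu]_x (h x * k x)%:E =
    \sum_(y \in range h) (y%:E * \int[mu]_(x in h @^-1` [set y]) (k x)%:E))%E.
  move=> mk k0.
  transitivity (\int[mu]_x (\sum_(y \in range h)
      (y * (\1_(h @^-1` [set y]) x * k x))%:E)%E)%E.
    apply: eq_integral => x _; rewrite fsumEFin//; congr (_%:E).
    rewrite {1}(fimfunE h x) !fsbig_finite//= mulr_suml.
    by apply: eq_bigr => y _; rewrite mulrA.
  have mind y : measurable_fun (setT : set T) (fun x => \1_(h @^-1` [set y]) x * k x).
    apply: measurable_funM => //; apply: measurable_indic; apply: Gm.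
    by apply/sub_measurableE; exact: measurable_sfunP.
  rewrite ge0_integral_fsum//.
  - apply: eq_fsbigr => y /[!inE] -[x _ <-].
    rewrite integral_in_indic; apply: ge0_integralZl_real.
    + exact: mind.
    + by move=> t; apply: mulr_ge0 => //; rewrite indicE.
    + exact: fun_ge0.
  - by move=> y; apply/measurable_EFinP; exact: measurable_funM.
  (* Nonnegativity is required for every real [y], even a negative one: off the fibre of [y] the
     term vanishes, and on it [y] is a value of [h]. *)
  - move=> y x _; rewrite lee_fin !indicE/=.
    have [<-|y0] := eqVneq (h x) y.
      by apply: mulr_ge0 => //; exact: mulr_ge0.
    by rewrite memNset ?mul0r ?mulr0//= => hy; rewrite hy eqxx in y0.
rewrite !E// lee_fsum// => y [x _ <-].
rewrite lee_wpmul2l ?lee_fin//; apply: fg; apply/sub_measurableE.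
exact: measurable_sfunP.
Qed.

(** Monotone approximation of [Z] by simple functions on [TG] reduces this to indicators of sets of
    [G]. Nonnegativity replaces integrability, so the integrals may be infinite. *)
Lemma le_integralM_sub (mu : {measure set T -> \bar R}) (Z f g : T -> R) :
  measurable_fun (setT : set TG) (Z : TG -> R) -> (forall x, 0 <= Z x) ->
  measurable_fun setT f -> measurable_fun setT g ->
  (forall x, 0 <= f x) -> (forall x, 0 <= g x) ->
  (forall A, G A -> \int[mu]_(x in A) (f x)%:E <= \int[mu]_(x in A) (g x)%:E)%E ->
  (\int[mu]_x (Z x * f x)%:E <= \int[mu]_x (Z x * g x)%:E)%E.
Proof.
move=> mZ Z0 mf mg f0 g0 fg.
have mZ' : measurable_fun (setT : set TG) (EFin \o Z) by exact/measurable_EFinP.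
pose h := nnsfun_approx measurableT mZ'.
have hm n : measurable_fun (setT : set T) (h n : T -> R).
  by apply: sub_measurable_fun.
have E (k : T -> R) : measurable_fun setT k -> (forall x, 0 <= k x) ->
    ((fun n => \int[mu]_x (h n x * k x)%:E) @ \oo --> \int[mu]_x (Z x * k x)%:E)%E.
  move=> mk k0.
  have -> : (\int[mu]_x (Z x * k x)%:E =
    \int[mu]_x (limn (fun n => (h n x)%:E * (k x)%:E)))%E.
    apply: eq_integral => x _; rewrite EFinM; apply/esym/cvg_lim => //.
    apply: cvgeZr => //; apply: cvg_nnsfun_approx => // t _.
    by rewrite lee_fin.
  apply: (@cvg_monotone_convergence _ _ _ mu setT measurableT
      (fun n x => (h n x)%:E * (k x)%:E)%E) => //.
  - by move=> n; apply/measurable_EFinP; exact: measurable_funM.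
  - by move=> n x _; rewrite lee_fin mulr_ge0.
  - move=> x _ a b ab; rewrite lee_fin ler_wpM2r//.
    by have /lefP := nd_nnsfun_approx measurableT mZ' ab; exact.
have Ef := E f mf f0; have Eg := E g mg g0.
rewrite -(cvg_lim _ Ef)// -(cvg_lim _ Eg)//; apply: lee_lim.
- by apply/cvg_ex; eexists; exact: Ef.
- by apply/cvg_ex; eexists; exact: Eg.
- by apply: nearW => n; exact: le_integral_nnsfunM.
Qed.

Lemma eq_integralM_sub (mu : {measure set T -> \bar R}) (Z f g : T -> R) :
  measurable_fun (setT : set TG) (Z : TG -> R) -> (forall x, 0 <= Z x) ->
  measurable_fun setT f -> measurable_fun setT g ->
  (forall x, 0 <= f x) -> (forall x, 0 <= g x) ->
  (forall A, G A -> \int[mu]_(x in A) (f x)%:E = \int[mu]_(x in A) (g x)%:E)%E ->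
  (\int[mu]_x (Z x * f x)%:E = \int[mu]_x (Z x * g x)%:E)%E.
Proof.
move=> mZ Z0 mf mg f0 g0 fg; apply/eqP; rewrite eq_le.
by apply/andP; split; apply: le_integralM_sub => // A GA; rewrite fg.
Qed.

Variable P : probability T R.

(** The restriction of [P] to [G], typed over [TG] so that densities with respect to it are
    [G]-measurable. *)
Definition subprob : set TG -> \bar R := P.

Let subprob0 : subprob set0 = 0%E. Proof. exact: measure0. Qed.

Let subprob_ge0 A : (0 <= subprob A)%E. Proof. exact: measure_ge0. Qed.

Let subprob_semi_sigma_additive : semi_sigma_additive subprob.
Proof.
move=> A mA tA mUA; apply: measure_semi_sigma_additive => //.
- by move=> n; apply: Gm; apply/sub_measurableE; exact: mA.
- by apply: Gm; apply/sub_measurableE; exact: mUA.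
Qed.

HB.instance Definition _ :=
  isMeasure.Build _ _ _ subprob subprob0 subprob_ge0 subprob_semi_sigma_additive.

Let subprob_setT : subprob setT = 1%E. Proof. exact: probability_setT. Qed.

HB.instance Definition _ := Measure_isProbability.Build _ _ _ subprob subprob_setT.

Let measurable_id_sub : measurable_fun (setT : set T) (id : T -> TG).
Proof. by move=> _ B /sub_measurableE/Gm mB; rewrite setTI. Qed.

(** [subprob] is the push-forward of [P] under the identity from [T] to [TG], so the change of
    variables formula applies. *)
Lemma integrable_subprob (f : TG -> \bar R) :
  subprob.-integrable setT f -> P.-integrable setT (f : T -> \bar R).
Proof.
move=> /integrableP[mf fy]; apply/integrableP; split.
  exact: sub_measurable_fun.
apply: le_lt_trans fy.
rewrite -[X in (_ <= X)%E]/(\int[pushforward P (id : T -> TG)]_x `|f x|)%E.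
rewrite ge0_integral_pushforward//; exact: measurableT_comp.
Qed.

Lemma integral_subprob (A : set TG) (f : TG -> \bar R) : G A ->
  subprob.-integrable setT f ->
  (\int[subprob]_(x in A) f x = \int[P]_(x in A) f x)%E.
Proof.
move=> GA intf.
rewrite -[LHS]/(\int[pushforward P (id : T -> TG)]_(x in A) f x)%E.
rewrite integral_pushforward//.
- exact: measurable_int intf.
- apply: (@integrableS _ _ _ _ setT) => //; first exact: Gm.
  exact: integrable_subprob.
- exact/sub_measurableE.
Qed.

(** The set where the inequality fails is itself in [G]; on it [g1 - g2] is positive but has a
    nonpositive integral. *)
Lemma ae_le_of_sub_integral (g1 g2 : T -> R) :
  measurable_fun (setT : set TG) (g1 : TG -> R) ->
  measurable_fun (setT : set TG) (g2 : TG -> R) ->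
  P.-integrable setT (EFin \o g1) -> P.-integrable setT (EFin \o g2) ->
  (forall A, G A -> \int[P]_(x in A) (g1 x)%:E <= \int[P]_(x in A) (g2 x)%:E)%E ->
  {ae P, forall x, g1 x <= g2 x}.
Proof.
move=> m1 m2 i1 i2 le12.
pose B := [set x | g2 x < g1 x].
have GB : G B.
  apply/sub_measurableE.
  have -> : B = setT `&` (fun x => g2 x < g1 x) @^-1` [set true].
    by apply/seteqP; split => x //= -[].
  by apply: (measurable_fun_ltr (D := (setT : set TG)) m2 m1).
have mB : measurable B by exact: Gm.
have i1B : P.-integrable B (EFin \o g1) by exact: integrableS i1.
have i2B : P.-integrable B (EFin \o g2) by exact: integrableS i2.
have mB12 : measurable_fun B (fun x => (g1 x - g2 x)%:E).
  apply/measurable_EFinP/measurable_funTS/measurable_funB;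
    exact: sub_measurable_fun.
have : (\int[P]_(x in B) `|(g1 x - g2 x)%:E| = 0)%E.
  apply/eqP; rewrite eq_le integral_ge0// andbT.
  under eq_integral.
    move=> x /[!inE] Bx; rewrite gee0_abs ?lee_fin ?subr_ge0 ?(ltW Bx)//.
    rewrite EFinB; over.
  by rewrite integralB_EFin// sube_le0; exact: le12.
move/(ae_eq_integral_abs P mB mB12) => ae0.
apply: filterS ae0 => x H; rewrite leNgt; apply/negP => Bx.
have /= := H Bx; case => /eqP; rewrite subr_eq0 => /eqP E.
by move: Bx; rewrite E ltxx.
Qed.

Section Existence.
Variable f : T -> R.
Hypothesis f0 : forall x, 0 <= f x.
Hypothesis intf : P.-integrable setT (EFin \o f).

(** The measure [f dP] restricted to [G]; its density with respect to [subprob] is the conditional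
    expectation. *)
Definition subcharge : set TG -> \bar R := fun A => (\int[P]_(x in A) (f x)%:E)%E.

Let subcharge0 : subcharge set0 = 0%E. Proof. exact: integral_set0. Qed.

Let subcharge_fin A : measurable A -> subcharge A \is a fin_num.
Proof.
move=> /sub_measurableE/Gm mA; apply: integrable_fin_num => //.
exact: integrableS intf.
Qed.

Let subcharge_semi_sigma_additive : semi_sigma_additive subcharge.
Proof.
move=> A mA tA mUA.
apply: (@semi_sigma_additive_nng_induced _ _ _ P (EFin \o f)) => //.
- exact: measurable_int intf.
- by move=> n; apply: Gm; apply/sub_measurableE; exact: mA.
- by apply: Gm; apply/sub_measurableE; exact: mUA.
Qed.

HB.instance Definition _ := isCharge.Build _ _ _ subcharge
  subcharge0 subcharge_fin subcharge_semi_sigma_additive.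

Lemma exists_condexp : exists g : T -> R,
  [/\ measurable_fun (setT : set TG) (g : TG -> R), forall x, 0 <= g x,
     P.-integrable setT (EFin \o g) &
     forall A, G A -> (\int[P]_(x in A) (g x)%:E = \int[P]_(x in A) (f x)%:E)%E].
Proof.
have dom : subcharge `<< subprob.
  apply/null_content_dominatesP => A /sub_measurableE/Gm mA PA.
  apply: null_set_integral => //.
  by apply: measurable_funTS; exact: measurable_int intf.
pose phi := Radon_Nikodym subcharge subprob.
have iphi : subprob.-integrable setT phi by exact: Radon_Nikodym_integrable.
have phifin x : phi x \is a fin_num by exact: Radon_Nikodym_fin_num.
pose u : T -> R := fine \o (phi : T -> \bar R).
have uE : EFin \o u = (phi : T -> \bar R) by apply/funext => x; rewrite /= fineK.
have mu : measurable_fun (setT : set TG) (u : TG -> R).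
  apply/measurable_EFinP; rewrite -[EFin \o _]/(EFin \o u : TG -> \bar R) uE.
  exact: measurable_int iphi.
have iu : P.-integrable setT (EFin \o u : T -> \bar R).
  by rewrite uE; exact: integrable_subprob.
have uf A : G A -> (\int[P]_(x in A) (u x)%:E = \int[P]_(x in A) (f x)%:E)%E.
  move=> GA; rewrite -[RHS]/(subcharge A) (Radon_Nikodym_integral dom); last first.
    exact/sub_measurableE.
  rewrite integral_subprob//.
  by apply: eq_integral => x _; rewrite /= fineK.
have u0 : {ae P, forall x, 0 <= u x}.
  apply: ae_le_of_sub_integral => //.
  - exact: integrable0.
  - move=> A GA; rewrite uf// integral0_eq// integral_ge0// => x _.
    by rewrite lee_fin.
(* The density is nonnegative only almost everywhere; its positive part is so everywhere, with the
   same integrals. *)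
pose g : T -> R := fun x => Num.max (u x) 0.
have mg : measurable_fun (setT : set TG) (g : TG -> R) by exact: measurable_maxr.
have ug : {ae P, forall x, u x = g x}.
  by apply: filterS u0 => x u0; rewrite /g; apply/esym/max_idPl.
exists g; split => //.
- by move=> x; rewrite /g le_max lexx orbT.
- apply: (le_integrable _ _ _ iu) => //.
  + by apply/measurable_EFinP; exact: sub_measurable_fun.
  + move=> x _ /=; rewrite lee_fin /g; case: (leP (u x) 0) => // _.
    by rewrite normr0.
- move=> A GA; rewrite -uf//; apply: ae_eq_integral => //.
  + exact: Gm.
  + by apply/measurable_EFinP/measurable_funTS; exact: sub_measurable_fun.
  + by apply/measurable_EFinP/measurable_funTS; exact: sub_measurable_fun.
  + case: ug => N [mN N0 ugN]; exists N; split => // x /= nE; apply: ugN => ugx.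
    by apply: nE => _ /=; rewrite ugx.
Qed.

End Existence.
End SubSigmaAlgebra.

(** * Hoelder and Doob *)

Section Hoelder.
Context {R : realType}.

Lemma measurable_fun_powR d (U : measurableType d) (D : set U) (f : U -> R) (r : R) :
  measurable_fun D f -> measurable_fun D (fun x => f x `^ r).
Proof. by move=> mf; exact: (measurableT_comp (measurable_powR r) mf). Qed.

Lemma conjugate_exponentM (p q : R) : 0 < p -> 0 < q -> p^-1 + q^-1 = 1 ->
  (p - 1) * q = p.
Proof.
move=> p0 q0 pq; have : p * q * (p^-1 + q^-1) = p * q by rewrite pq mulr1.
rewrite mulrDr mulrAC mulfV ?gt_eqF// mul1r mulfK ?gt_eqF// => E.
by rewrite mulrBl mul1r -E; ring.
Qed.

(** For [b > 0], writing [b = b^(1/p) b^(1/q)] lets [b^(1/q)] be cancelled. *)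
Lemma selfbound_powR (c h b p q : R) : 0 <= c -> 0 <= h -> 0 <= b ->
  0 < p -> 0 < q -> p^-1 + q^-1 = 1 ->
  b <= c * (h `^ p^-1 * b `^ q^-1) -> b <= c `^ p * h.
Proof.
move=> c0 h0 b0 p0 q0 pq H.
move: b0; rewrite le_eqVlt => /orP[/eqP<-|b0]; first by rewrite mulr_ge0 ?powR_ge0.
have bE : b = b `^ p^-1 * b `^ q^-1.
  by rewrite -powRD ?pq ?powRr1 ?(ltW b0)// oner_eq0.
have {}H : b `^ p^-1 <= c * h `^ p^-1.
  by move: H; rewrite {1}bE mulrA ler_pM2r// powR_gt0.
have pE : p^-1 * p = 1 by rewrite mulVf// gt_eqF.
have := ge0_ler_powR (ltW p0) _ _ H.
rewrite !nnegrE powR_ge0 mulr_ge0 ?powR_ge0// => /(_ isT isT).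
by rewrite -powRrM pE powRr1 ?(ltW b0)// powRM ?powR_ge0// -powRrM pE powRr1.
Qed.

(** Finiteness of [b] legitimates the cancellation: [b = +oo] would satisfy the inequality for every
    [h > 0]. *)
Lemma selfbound_poweR (c : R) (h b : \bar R) (p q : R) : 0 < c ->
  (0 <= h)%E -> (0 <= b)%E -> (b < +oo)%E ->
  0 < p -> 0 < q -> p^-1 + q^-1 = 1 ->
  (b <= c%:E * (h `^ p^-1 * b `^ q^-1))%E -> (b <= (c `^ p)%:E * h)%E.
Proof.
move=> c0 h0 b0 b_fin p0 q0 pq.
case: h h0 => [h h0|_|//]; last first.
  by rewrite gt0_muley ?leey// lte_fin powR_gt0.
case: b b0 b_fin => [b b0 _|//|//].
rewrite !poweR_EFin -!EFinM !lee_fin.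
exact: selfbound_powR (ltW c0) h0 b0 p0 q0 pq.
Qed.

(* Young's inequality for [a] and [b `^ (p - 1)], rearranged. *)
Lemma powR_increment (a b p q : R) : 0 <= b -> b <= a -> 0 < p -> 0 < q ->
  p^-1 + q^-1 = 1 ->
  a `^ p - b `^ p <= q * (a * (a `^ (p - 1) - b `^ (p - 1))).
Proof.
move=> b0 ba p0 q0 pq; have a0 := le_trans b0 ba.
have p0' : p != 0 by rewrite gt_eqF.
have q0' : q != 0 by rewrite gt_eqF.
have qE := conjugate_exponentM p0 q0 pq.
have := conjugate_powR a0 (powR_ge0 b (p - 1)) p0 q0 pq.
rewrite -powRrM qE => Y.
have aE : a * a `^ (p - 1) = a `^ p by rewrite mulr_powRB1.
rewrite mulrBr aE.
have qp : q * p^-1 = q - 1.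
  have -> : p^-1 = 1 - q^-1 by rewrite -pq addrK.
  by rewrite mulrBr mulr1 mulfV.
have : q * (a * b `^ (p - 1)) <= q * (a `^ p / p + b `^ p / q).
  by rewrite ler_pM2l.
have -> : q * (a `^ p / p + b `^ p / q) = a `^ p * (q - 1) + b `^ p.
  by rewrite -qp; field; rewrite p0' q0'.
rewrite mulrBr mulrBr mulr1 (mulrC (a `^ p)) => ?; lra.
Qed.

Context {d : measure_display} {T : measurableType d}.
Variable mu : {measure set T -> \bar R}.

(** Hoelder for [f w^(1/p)] and [g v^(1/q)]. Two weights are needed to pair a maximal function in
    [L^q(w)] with one in [L^p(sigma)]. *)
Lemma hoelder_weighted (f g w v : T -> R) (p q : R) :
  measurable_fun setT f -> measurable_fun setT g ->
  measurable_fun setT w -> measurable_fun setT v ->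
  (forall x, 0 <= f x) -> (forall x, 0 <= g x) ->
  (forall x, 0 <= w x) -> (forall x, 0 <= v x) ->
  0 < p -> 0 < q -> p^-1 + q^-1 = 1 ->
  (\int[mu]_x (f x * g x * (w x `^ p^-1 * v x `^ q^-1))%:E <=
   (\int[mu]_x (f x `^ p * w x)%:E) `^ p^-1 *
   (\int[mu]_x (g x `^ q * v x)%:E) `^ q^-1)%E.
Proof.
move=> mf mg mw mv f0 g0 w0 v0 p0 q0 pq.
pose F x := f x * w x `^ p^-1; pose H x := g x * v x `^ q^-1.
have mF : measurable_fun setT F.
  by apply: measurable_funM => //; exact: measurable_fun_powR.
have mH : measurable_fun setT H.
  by apply: measurable_funM => //; exact: measurable_fun_powR.
have := @hoelder _ _ _ mu F H p q mF mH p0 q0 pq.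
rewrite Lnorm1 unlock /=.
have FE (k u : R) (r : R) : 0 <= k -> 0 <= u -> 0 < r ->
    `|k * u `^ r^-1| `^ r = k `^ r * u.
  move=> k0 u0 r0; rewrite ger0_norm ?mulr_ge0 ?powR_ge0//.
  by rewrite powRM ?powR_ge0// -powRrM mulVf ?gt_eqF// powRr1.
under eq_integral => x _.
  rewrite ger0_norm; last by rewrite /F /H !mulr_ge0 ?powR_ge0.
  rewrite /F /H mulrACA; over.
move=> /le_trans; apply; rewrite le_eqVlt; apply/orP; left; apply/eqP.
congr ((_ `^ _) * (_ `^ _))%E; apply: eq_integral => x _;
  by rewrite /= /F /H FE.
Qed.

(** Allows a function to be replaced by its truncations, whose weighted integrals are finite and can
    be cancelled. *)
Lemma integral_truncated_le (X w : T -> R) (q : R) (B : \bar R) : 0 < q ->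
  measurable_fun setT X -> measurable_fun setT w ->
  (forall x, 0 <= X x) -> (forall x, 0 <= w x) ->
  (forall N : nat, \int[mu]_x (Num.min (X x) N%:R `^ q * w x)%:E <= B)%E ->
  (\int[mu]_x (X x `^ q * w x)%:E <= B)%E.
Proof.
move=> q0 mX mw X0 w0 HB.
pose g n x := ((Num.min (X x) n%:R) `^ q * w x)%:E.
have -> : (\int[mu]_x (X x `^ q * w x)%:E = \int[mu]_x limn (g ^~ x))%E.
  apply: eq_integral => x _; apply/esym/lim_near_cst => //.
  exists (Num.truncn (X x)).+1 => // n /= Xn; rewrite /g min_l//.
  apply: (le_trans (ltW (truncnS_gt _))); by rewrite ler_nat.
have cv : (fun n => \int[mu]_x g n x)%E @ \oo --> (\int[mu]_x limn (g ^~ x))%E.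
  apply: cvg_monotone_convergence => //.
  - move=> n; apply/measurable_EFinP/measurable_funM => //.
    by apply: measurable_fun_powR; exact: measurable_minr.
  - by move=> n x _; rewrite lee_fin mulr_ge0 ?powR_ge0.
  - move=> x _ a b ab; rewrite lee_fin ler_wpM2r//.
    rewrite ge0_ler_powR ?(ltW q0)// ?nnegrE ?le_min ?X0//=.
    by rewrite ge_min lexx/= ge_min ler_nat ab orbT.
rewrite -(cvg_lim _ cv)//; apply: lime_le.
  by apply/cvg_ex; eexists; exact: cv.
exact: nearW.
Qed.

End Hoelder.

(** * Doob's maximal inequality for a weighted measure *)

Section Doob.
Context {d : measure_display} {T : measurableType d} {R : realType}.
Variables (mu : {finite_measure set T -> \bar R}) (F : nat -> set (set T)).
Hypothesis sF : forall n, sigma_algebra setT (F n).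
Hypothesis Fm : forall n, F n `<=` measurable.
Hypothesis Fmono : forall m n, (m <= n)%N -> F m `<=` F n.

Lemma filtration_measurable_fun m n d' (U : measurableType d') (f : T -> U) :
  (m <= n)%N ->
  measurable_fun (setT : set (g_sigma_algebraType (F m))) f ->
  measurable_fun (setT : set (g_sigma_algebraType (F n))) f.
Proof.
move=> mn mf _ B mB; apply/(sub_measurableE (sF n)); apply: (Fmono mn).
by apply/(sub_measurableE (sF m)); exact: mf.
Qed.

(** A finite stand-in for the Doob maximal function: real-valued and [F n]-measurable, with bounds
    independent of [n]. *)
Fixpoint running_max (X : nat -> T -> R) (n : nat) (x : T) : R :=
  if n is m.+1 then Num.max (running_max X m x) (X n x) else X 0%N x.

Lemma running_max_ge X n k x : (k <= n)%N -> X k x <= running_max X n x.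
Proof.
elim: n => [|n IH]; first by rewrite leqn0 => /eqP ->.
rewrite leq_eqVlt => /orP[/eqP->|]; rewrite /= le_max; first by rewrite lexx orbT.
by rewrite ltnS => /IH ->.
Qed.

Lemma measurable_running_max X n :
  (forall n, measurable_fun (setT : set (g_sigma_algebraType (F n))) (X n)) ->
  measurable_fun (setT : set (g_sigma_algebraType (F n))) (running_max X n).
Proof.
move=> mX; elim: n => [|n IH]/=; first exact: mX.
by apply: measurable_maxr => //; exact: filtration_measurable_fun IH.
Qed.

(** The integral identity says that [X n] is the conditional expectation of [g] given [F n] under
    [w dmu]. No weak-type estimate is used: the truncated maximum [a] moves only at times when it is
    at most the new [X], which may be replaced by [g] against measurable factors, and the increments
    of [a^(p-1)] telescope. *)
Lemma doob_running_max (X : nat -> T -> R) (g w : T -> R) (p q : R) (n : nat) :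
  (forall n, measurable_fun (setT : set (g_sigma_algebraType (F n))) (X n)) ->
  (forall n x, 0 <= X n x) ->
  measurable_fun setT g -> (forall x, 0 <= g x) ->
  mu.-integrable setT (EFin \o w) -> (forall x, 0 < w x) ->
  (forall n A, F n A ->
    \int[mu]_(x in A) (X n x * w x)%:E = \int[mu]_(x in A) (g x * w x)%:E)%E ->
  1 < p -> 0 < q -> p^-1 + q^-1 = 1 ->
  (\int[mu]_x (running_max X n x `^ p * w x)%:E <=
    (q `^ p)%:E * \int[mu]_x (g x `^ p * w x)%:E)%E.
Proof.
move=> mX X0 mg g0 iw w0 HX p1 q0 pq; have p0 : 0 < p by lra.
have mw : measurable_fun setT w by apply/measurable_EFinP; exact: measurable_int iw.
have w0' x : 0 <= w x by exact: ltW.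
have Xm k : measurable_fun setT (X k) by apply: (sub_measurable_fun (sF k) (@Fm k)).
have M0 k x : 0 <= running_max X k x.
  by apply: (le_trans (X0 0%N x)); exact: running_max_ge.
have Mm k : measurable_fun setT (running_max X k).
  by apply: (sub_measurable_fun (sF k) (@Fm k)); exact: measurable_running_max.
apply: integral_truncated_le => // N.
pose a k x := Num.min (running_max X k x) N%:R.
have a0 k x : 0 <= a k x by rewrite le_min M0/=.
have am k : measurable_fun (setT : set (g_sigma_algebraType (F k))) (a k).
  by apply: measurable_minr => //; exact: measurable_running_max.
have am' k : measurable_fun setT (a k) by apply: (sub_measurable_fun (sF k) (@Fm k)).
have apm k r : measurable_fun (setT : set (g_sigma_algebraType (F k)))
    (fun x => a k x `^ r).
  exact: measurable_fun_powR.
have apm' k r : measurable_fun setT (fun x => a k x `^ r).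
  by apply: (sub_measurable_fun (sF k) (@Fm k)).
have aS k x : a k x <= a k.+1 x.
  by rewrite /a/= le_min !ge_min lexx orbT andbT le_max lexx.
have p10 : 0 <= p - 1 by lra.
have XZ k (Z : T -> R) : measurable_fun (setT : set (g_sigma_algebraType (F k))) Z ->
    (forall x, 0 <= Z x) ->
    (\int[mu]_x (Z x * (X k x * w x))%:E = \int[mu]_x (Z x * (g x * w x))%:E)%E.
  move=> mZ Z0; apply: (eq_integralM_sub (sF k) (@Fm k)) => //.
  - exact: measurable_funM.
  - exact: measurable_funM.
  - by move=> x; rewrite mulr_ge0.
  - by move=> x; rewrite mulr_ge0.
  - exact: HX.
have key k : (\int[mu]_x (a k x `^ p * w x)%:E <=
    q%:E * \int[mu]_x (a k x `^ (p - 1) * (g x * w x))%:E)%E.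
  elim: k => [|k IH].
    rewrite -(XZ 0%N)//; last by move=> x; rewrite powR_ge0.
    rewrite -ge0_integralZl_real//; last 3 first.
    - by apply: measurable_funM => //; exact: measurable_funM.
    - by move=> x; rewrite !mulr_ge0 ?powR_ge0.
    - exact: ltW.
    apply: ge0_le_integral_EFin.
    - exact: measurable_funM.
    - apply: measurable_funM => //.
      by apply: measurable_funM => //; exact: measurable_funM.
    - by move=> x; rewrite mulr_ge0 ?powR_ge0.
    - move=> x; rewrite !mulrA ler_wpM2r//.
      have q1 : 1 <= q.
        have : q^-1 <= 1 by rewrite -pq lerDr invr_ge0 ltW.
        by rewrite invf_le1.
      rewrite -(mulr_powRB1 (a0 0%N x) p0) mulrC -mulrA -[X in X <= _]mul1r.
      apply: ler_pM => //; first by rewrite mulr_ge0 ?powR_ge0.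
      by rewrite ler_wpM2l ?powR_ge0// /a/= ge_min lexx.
  pose D x := a k.+1 x `^ (p - 1) - a k x `^ (p - 1).
  have D0 x : 0 <= D x.
    by rewrite subr_ge0 ge0_ler_powR// nnegrE.
  have mD : measurable_fun (setT : set (g_sigma_algebraType (F k.+1))) D.
    by apply: measurable_funB => //; exact: filtration_measurable_fun (apm _ _).
  have mD' : measurable_fun setT D by apply: (sub_measurable_fun (sF k.+1) (@Fm k.+1)).
  apply: (@le_trans _ _ (\int[mu]_x (a k x `^ p * w x)%:E +
      q%:E * \int[mu]_x (D x * (X k.+1 x * w x))%:E)%E).
    rewrite -ge0_integralZl_real//; last 3 first.
    - by apply: measurable_funM => //; exact: measurable_funM.
    - by move=> x; rewrite !mulr_ge0 ?powR_ge0.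
    - exact: ltW.
    have m3 : measurable_fun setT (fun x => q * (D x * (X k.+1 x * w x))).
      apply: measurable_funM => //.
      by apply: measurable_funM => //; exact: measurable_funM.
    rewrite -ge0_integralD_real//; last 3 first.
    - exact: measurable_funM.
    - by move=> x; rewrite mulr_ge0 ?powR_ge0.
    - by move=> x; rewrite !mulr_ge0// ltW.
    apply: ge0_le_integral_EFin.
    - exact: measurable_funM.
    - by apply: measurable_funD => //; exact: measurable_funM.
    - by move=> x; rewrite mulr_ge0 ?powR_ge0.
    - move=> x; rewrite !mulrA -mulrDl ler_wpM2r// -lerBlDl.
      apply: (le_trans (powR_increment (a0 k x) (aS k x) p0 q0 pq)).
      rewrite -mulrA ler_wpM2l ?(ltW q0)// -/(D x) mulrC.
      have [aX|aX] := leP (a k.+1 x) (X k.+1 x); first exact: ler_wpM2l.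
      (* the truncated maximum does not move at a time when it exceeds [X] *)
      have -> : D x = 0; last by rewrite !mul0r.
      rewrite /D; suff -> : a k.+1 x = a k x by rewrite subrr.
      move: aX; rewrite /a /= lt_min => /andP[+ _].
      by rewrite lt_max ltxx orbF => /ltW XM; rewrite max_l.
  rewrite (XZ k.+1 D mD D0).
  apply: (@le_trans _ _ (q%:E * \int[mu]_x (a k x `^ (p - 1) * (g x * w x))%:E +
    q%:E * \int[mu]_x (D x * (g x * w x))%:E)%E).
    exact: leeD2r.
  clear IH.
  rewrite -ge0_muleDr; last 2 first.
  - by apply: integral_ge0 => x _; rewrite lee_fin !mulr_ge0 ?powR_ge0.
  - by apply: integral_ge0 => x _; rewrite lee_fin !mulr_ge0.
  rewrite -ge0_integralD_real; last 4 first.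
  - by apply: measurable_funM => //; exact: measurable_funM.
  - by move=> x; rewrite !mulr_ge0 ?powR_ge0.
  - by apply: measurable_funM => //; exact: measurable_funM.
  - by move=> x; rewrite !mulr_ge0.
  rewrite le_eqVlt; apply/orP; left; apply/eqP; congr (_ * _)%E.
  by apply: eq_integral => x _; congr (_%:E); rewrite -mulrDl /D addrC subrK.
(* The truncation at [N] and the integrability of [w] supply the finiteness that [selfbound_poweR]
   requires. *)
have fin : (\int[mu]_x (a n x `^ p * w x)%:E < +oo)%E.
  apply: (@le_lt_trans _ _ (\int[mu]_x (N%:R `^ p * w x)%:E)%E).
    apply: ge0_le_integral_EFin.
    - exact: measurable_funM.
    - exact: measurable_funM.
    - by move=> x; rewrite mulr_ge0 ?powR_ge0.
    - move=> x; rewrite ler_wpM2r// ge0_ler_powR ?nnegrE ?(ltW p0)//.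
      by rewrite /a ge_min lexx orbT.
  rewrite ge0_integralZl_real ?powR_ge0//.
  have := integrable_fin_num measurableT iw.
  rewrite /= => /fineK <-; rewrite -EFinM; exact: ltry.
apply: (@selfbound_poweR R q _ _ p q) => //.
- by apply: integral_ge0 => x _; rewrite lee_fin mulr_ge0 ?powR_ge0.
- by apply: integral_ge0 => x _; rewrite lee_fin mulr_ge0 ?powR_ge0.
apply: (le_trans (key n)).
apply: lee_wpmul2l; first by rewrite lee_fin ltW.
have qE := conjugate_exponentM p0 q0 pq.
have := @hoelder_weighted R _ _ mu g (fun x => a n x `^ (p - 1)) w w p q mg (apm' _ _)
  mw mw g0 (fun x => powR_ge0 _ _) w0' w0' p0 q0 pq.
under [X in (_ <= _ * X `^ _)%E -> _]eq_integral do rewrite -powRrM qE.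
apply: le_trans; rewrite le_eqVlt; apply/orP; left; apply/eqP.
apply: eq_integral => x _; congr (_%:E).
rewrite -powRD ?pq ?powRr1//; first by ring.
by rewrite oner_eq0.
Qed.

End Doob.

(** * Local spaces *)

Section LocalSpaces.
Context {d : measure_display} {T : measurableType d} {R : realType}.
Variables (P : probability T R) (F : nat -> set (set T)) (tau : nat -> T -> option nat).
Hypothesis sF : forall n, sigma_algebra setT (F n).
Hypothesis Fm : forall n, F n `<=` measurable.
Hypothesis Fmono : forall m n, (m <= n)%N -> F m `<=` F n.

Let F0 n : F n set0. Proof. by have [] := sF n. Qed.

Let FT n : F n setT.
Proof. by have [_ FC _] := sF n; rewrite -(setD0 setT); exact: FC. Qed.

Let Fbigcup n (A : nat -> set T) : (forall k, F n (A k)) -> F n (\bigcup_k A k).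
Proof. by have [_ _] := sF n; exact. Qed.

Let FI n A B : F n A -> F n B -> F n (A `&` B).
Proof.
move=> /(sub_measurableE (sF n)) mA /(sub_measurableE (sF n)) mB.
by apply/(sub_measurableE (sF n)); exact: measurableI.
Qed.

(* The sum of the first [i] local times: the local space [spaces i] is the
   base space restricted to [{total i < oo}] and shifted by [total i]. *)
Fixpoint total (i : nat) (x : T) : option nat :=
  if i is j.+1 then obind (fun m => omap (addn m) (tau j x)) (total j x)
  else Some 0%N.

Definition level (i k : nat) : set T := [set x | total i x = Some k].

Definition reached (i : nat) : set T := [set x | total i x <> None].

Lemma levelS i k j x : total i x = Some k -> tau i x = Some j ->
  total i.+1 x = Some (k + j)%N.
Proof. by move=> /= -> /= ->. Qed.

Lemma totalS_inv i l x : total i.+1 x = Some l ->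
  exists k j, [/\ total i x = Some k, tau i x = Some j & l = (k + j)%N].
Proof.
move=> /=; case: (total i x) => [k|]//=; case: (tau i x) => [j|]//= [<-].
by exists k, j.
Qed.

(** The invariant of the construction: [P] conditioned on [reached i], with the base filtration at
    the times [total i + m], described level by level. The constant [c] collects the normalising
    factors of the earlier stages. *)
Record shifted_space (i : nat) : Prop := ShiftedSpace {
  shifted_carrier : carrier (spaces P F tau i) = reached i;
  shifted_events : forall A,
    events (spaces P F tau i) A <-> measurable A /\ A `<=` reached i;
  shifted_prob : exists2 c : R, 0 < c &
    forall A, prob (spaces P F tau i) A = (c%:E * P (A `&` reached i))%E;
  shifted_filt : forall m A, filt (spaces P F tau i) m A <->
    A `<=` reached i /\ forall k, F (k + m) (A `&` level i k);
  shifted_level : forall k, F k (level i k);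
  shifted_time : forall k n, F (k + n) (level i k `&` [set x | tau i x = Some n]) }.

Lemma measurable_of_levels i m A : A `<=` reached i ->
  (forall k, F (k + m) (A `&` level i k)) -> measurable A.
Proof.
move=> AC FA; have -> : A = \bigcup_k (A `&` level i k).
  apply/seteqP; split => [x Ax|x [k _ []]//].
  by have := AC _ Ax; rewrite /reached/=; case E: (total i x) => [k|]// _; exists k.
by apply: bigcupT_measurable => k; exact: Fm (FA k).
Qed.

Lemma measurable_reached i : (forall k, F k (level i k)) -> measurable (reached i).
Proof.
move=> FL; apply: (@measurable_of_levels i 0%N) => // k.
rewrite addn0; have -> : reached i `&` level i k = level i k; last exact: FL.
by apply/seteqP; split => [x []//|x]; rewrite /level /reached/= => ->.
Qed.

(** Stopping the local filtration at [tau i + m] is stopping the base filtration at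
    [total i.+1 + m]; both directions split over the value of [total i]. This carries the invariant
    to the next stage. *)
Lemma stopped_sigma_shiftE i m B : shifted_space i ->
  stopped_sigma (spaces P F tau i) (time_shift (tau i) m) B <->
  [/\ measurable B, B `<=` reached i & forall l, F (l + m) (B `&` level i.+1 l)].
Proof.
move=> S; rewrite /stopped_sigma/=; split.
- move=> [/(shifted_events S)[mB BC] FB]; split => // l.
  (* A point of level [l] with earlier total [k] has local time [l - k], and local time [l - k + m]
     is base time [l + m] there. *)
  have -> : B `&` level i.+1 l = \bigcup_k (if (k <= l)%N then
      (B `&` t_le (spaces P F tau i) (time_shift (tau i) m) (l - k + m) `&` level i k)
       `&` (level i k `&` [set x | tau i x = Some (l - k)%N]) else set0).
    apply/seteqP; split => [x [Bx /totalS_inv[k [j [tk tj ->]]]]|x [k _]].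
      exists k => //; rewrite leq_addr addKn; split => //; split => //; split => //.
      split; first by rewrite (shifted_carrier S); exact: BC.
      by exists (j + m)%N => //=; rewrite /time_shift tj.
    case: ifP => // kl [[[Bx _] _] [Lx tx]]; split => //.
    by have := levelS Lx tx; rewrite subnKC.
  apply: Fbigcup => k; case: ifP => // kl; apply: FI.
    have /(shifted_filt S)[_ /(_ k)] := FB (l - k + m)%N.
    by rewrite addnA subnKC.
  apply: (@Fmono (k + (l - k))); first by rewrite subnKC// leq_addr.
  exact: (shifted_time S).
- move=> [mB BC FB]; split; first exact/(shifted_events S).
  move=> n; apply/(shifted_filt S); split; first by move=> x [/BC].
  move=> k.
  have -> : B `&` t_le (spaces P F tau i) (time_shift (tau i) m) n `&` level i k =
    \bigcup_j (if (j + m <= n)%N then (B `&` level i.+1 (k + j)) `&`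
      (level i k `&` [set x | tau i x = Some j]) else set0).
    apply/seteqP; split => [x [[Bx [Cx [l tl jn]]] Lx]|x [j _]].
      move: tl jn; rewrite /time_shift/=; case tx: (tau i x) => [j|]//= [<-] jn.
      by exists j => //; rewrite jn; split; split => //; exact: levelS.
    case: ifP => // jn [[Bx _] [Lx tx]]; split => //; split => //; split.
      by rewrite (shifted_carrier S); exact: BC.
    by exists (j + m)%N => //; rewrite /time_shift tx.
  apply: Fbigcup => j; case: ifP => // jn; apply: FI.
    apply: (@Fmono (k + j + m)); first by rewrite -addnA leq_add2l.
    exact: FB.
  apply: (@Fmono (k + j)); last exact: (shifted_time S).
  by rewrite leq_add2l (leq_trans (leq_addr m j)).
Qed.

Lemma stopped_sigmaE i B : shifted_space i ->
  stopped_sigma (spaces P F tau i) (tau i) B <->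
  [/\ measurable B, B `<=` reached i & forall l, F l (B `&` level i.+1 l)].
Proof.
move=> S; have -> : tau i = time_shift (tau i) 0.
  by apply/funext => x; rewrite /time_shift; case: (tau i x) => //= k; rewrite addn0.
rewrite stopped_sigma_shiftE//.
by split=> -[mB BC FB]; split => // l; have := FB l; rewrite addn0.
Qed.

Lemma Eset_reached i : shifted_space i -> Eset P F tau i = reached i.+1.
Proof.
move=> S; rewrite /Eset /t_fin (shifted_carrier S) /reached; apply/seteqP.
split => x /=; first by case: (total i x) => [k|][//=]; case: (tau i x).
by case: (total i x) => [k|]//=; case: (tau i x) => [j|]//= _; split.
Qed.

Lemma shifted_levelS i : shifted_space i -> forall l, F l (level i.+1 l).
Proof.
move=> S l.
have -> : level i.+1 l = \bigcup_k (if (k <= l)%N then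
    level i k `&` [set x | tau i x = Some (l - k)%N] else set0).
  apply/seteqP; split => [x /totalS_inv[k [j [tk tj ->]]]|x [k _]].
    by exists k => //; rewrite leq_addr addKn.
  by case: ifP => // kl [Lx tx]; have := levelS Lx tx; rewrite subnKC.
apply: Fbigcup => k; case: ifP => // kl; rewrite -{1}(subnKC kl).
exact: (shifted_time S).
Qed.

Lemma stopping_time_level j :
  carrier (spaces P F tau j) = reached j ->
  (forall m A, filt (spaces P F tau j) m A <->
    A `<=` reached j /\ forall k, F (k + m) (A `&` level j k)) ->
  stopping_time (spaces P F tau j) (tau j) ->
  forall k n, F (k + n) (level j k `&` [set x | tau j x = Some n]).
Proof.
move=> Cj Fj st k n; have /Fj[_ /(_ k)] := st n.
rewrite /t_eq Cj; congr (F _ _); apply/seteqP.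
split => [x [[_ tx] Lx]//|x [Lx tx]]; split => //; split => //.
by move: Lx; rewrite /level /reached/= => ->.
Qed.

Lemma shifted_space0 : (forall x, tau 0%N x = Some 0%N) -> shifted_space 0.
Proof.
move=> t0.
have C0 : reached 0 = setT by apply/seteqP; split => x.
have L0 k : level 0 k = if k == 0%N then setT else set0.
  by case: k => [|k]; apply/seteqP; split => x.
split => //.
- by move=> A; rewrite C0; split => [mA|[]//]; split.
- by exists 1 => // A; rewrite mul1e C0 setIT.
- move=> m A /=; rewrite C0; split => [FA|[_ /(_ 0%N)]].
    split => // k; rewrite L0; case: eqP => [->|_]; last by rewrite setI0.
    by rewrite setIT.
  by rewrite L0/= setIT.
- by move=> k; rewrite L0; case: eqP.
- move=> k n; apply: FI; first by rewrite L0; case: eqP.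
  case: n => [|n].
    have -> : [set x | tau 0%N x = Some 0%N] = setT; last exact: FT.
    by apply/seteqP; split => x //= _; exact: t0.
  have -> : [set x | tau 0%N x = Some n.+1] = set0; last exact: F0.
  by apply/seteqP; split => x //=; rewrite t0.
Qed.

Lemma shifted_spaceS i : shifted_space i ->
  (0 < prob (spaces P F tau i) (Eset P F tau i))%E ->
  filter_shifted (spaces P F tau i) (tau i) (tau i.+1) -> shifted_space i.+1.
Proof.
move=> S E0; rewrite /filter_shifted -/(Eset P F tau i) E0.
rewrite -/(spaces P F tau i.+1) => st.
have EE := Eset_reached S.
have LS := shifted_levelS S.
have mE : measurable (reached i.+1) by exact: measurable_reached.
have EC : reached i.+1 `<=` reached i.
  by move=> x; rewrite /reached/=; case: (total i x).
have spE : spaces P F tau i.+1 = FSpace (reached i.+1)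
      (strace (events (spaces P F tau i)) (reached i.+1))
      (fun A => (prob (spaces P F tau i) (A `&` reached i.+1) *
        (fine (prob (spaces P F tau i) (reached i.+1)))^-1%:E)%E)
      (fun n => strace (stopped_sigma (spaces P F tau i) (time_shift (tau i) n))
                 (reached i.+1)).
  by rewrite /= /local_space -/(Eset P F tau i) E0 EE.
have Ci : carrier (spaces P F tau i.+1) = reached i.+1 by rewrite spE.
have Fi m A : filt (spaces P F tau i.+1) m A <->
    A `<=` reached i.+1 /\ forall k, F (k + m) (A `&` level i.+1 k).
  rewrite spE; split => [[B /(stopped_sigma_shiftE _ _ S)[mB BC FB] <-]|[AC FA]].
    split => // k; have := FB k; congr (F _ _); apply/seteqP.
    split => [x [Bx Lx]|x [[Bx _] Lx]]; split => //; split => //.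
    by move: Lx; rewrite /level /reached/= => ->.
  exists A; last by apply/seteqP; split => [x []//|x Ax]; split => //; exact: AC.
  apply/(stopped_sigma_shiftE _ _ S); split => //.
  - exact: measurable_of_levels FA.
  - exact: subset_trans EC.
split => //.
- move=> A; rewrite spE; split => [[B /(shifted_events S)[mB BC] <-]|[mA AC]].
    by split; [exact: measurableI|].
  exists A; last by apply/seteqP; split => [x []//|x Ax]; split => //; exact: AC.
  by apply/(shifted_events S); split => //; exact: subset_trans EC.
- have [c c0 cE] := shifted_prob S.
  (* Finiteness and positivity make [fine] return the true probability; the new constant is the old
     one divided by it. *)
  have Pfin : prob (spaces P F tau i) (reached i.+1) \is a fin_num.
    rewrite cE fin_numM// fin_num_measure//; apply: measurableI => //.
    exact: measurable_reached (shifted_level S).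
  have Ppos : 0 < fine (prob (spaces P F tau i) (reached i.+1)).
    by rewrite fine_gt0// -EE E0/= EE ltey_eq Pfin.
  rewrite spE; set z := fine _ in Ppos *; exists (c / z); first by rewrite divr_gt0.
  by move=> A /=; rewrite cE EFinM muleAC -setIA (setIidl EC).
- exact: stopping_time_level.
Qed.

(** Once a stage has probability zero, space and time stay frozen by definition, so every later
    [Eset] is the same null set and the second alternative persists. *)
Lemma spaces_dichotomy : local_times P F tau -> forall i,
  shifted_space i \/
  [/\ measurable (Eset P F tau i), P (Eset P F tau i) = 0%E &
      ~~ (0 < prob (spaces P F tau i) (Eset P F tau i))%E].
Proof.
move=> [t0 fs]; elim=> [|i IH]; first by left; exact: shifted_space0.
have [E0|nE0] := boolP (0 < prob (spaces P F tau i) (Eset P F tau i))%E.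
  by case: IH => [S|[_ _ /negP//]]; left; exact: shifted_spaceS.
right.
have [mE PE] : measurable (Eset P F tau i) /\ P (Eset P F tau i) = 0%E.
  case: IH => [S|[]//]; have mE : measurable (Eset P F tau i).
    by rewrite Eset_reached//; exact: measurable_reached (shifted_levelS S).
  split => //; move: nE0; have [c c0 ->] := shifted_prob S.
  have -> : Eset P F tau i `&` reached i = Eset P F tau i.
    by apply/setIidl; rewrite Eset_reached// => x; rewrite /reached/=; case: (total i x).
  rewrite -leNgt => H; apply/eqP; rewrite eq_le measure_ge0 andbT.
  by rewrite -(@pmule_rle0 _ c%:E).
have := fs i; rewrite /filter_shifted -/(Eset P F tau i) (negbTE nE0) => tE.
have spE : spaces P F tau i.+1 = spaces P F tau i.
  by rewrite /= /local_space -/(Eset P F tau i) (negbTE nE0).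
have EE : Eset P F tau i.+1 = Eset P F tau i.
  rewrite /Eset spE /t_fin; apply/seteqP.
  by split => x [Cx]; rewrite /= (tE _ Cx).
by rewrite EE spE.
Qed.

Lemma Eset_subset : local_times P F tau -> forall i, Eset P F tau i.+1 `<=` Eset P F tau i.
Proof.
move=> lt i; have [_ fs] := lt.
have [E0|nE0] := boolP (0 < prob (spaces P F tau i) (Eset P F tau i))%E.
  by rewrite {1}/Eset /= /local_space -/(Eset P F tau i) E0 => x [].
have := fs i; rewrite /filter_shifted -/(Eset P F tau i) (negbTE nE0) => tE.
rewrite {1}/Eset /= /local_space -/(Eset P F tau i) (negbTE nE0).
by move=> x [Cx]; rewrite /= (tE _ Cx).
Qed.

Lemma measurable_Eset : local_times P F tau -> forall i, measurable (Eset P F tau i).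
Proof.
move=> lt i; case: (spaces_dichotomy lt i) => [S|[]//].
by rewrite Eset_reached//; exact: measurable_reached (shifted_levelS S).
Qed.

(** The set function of the record is a scaled restriction of [P], hence a measure. One [c] serves
    all sets and functions, so it cancels in averaging identities. *)
Lemma integral_shifted_prob i : shifted_space i ->
  exists2 c : R, 0 < c &
  forall A (f : T -> R), measurable A -> A `<=` reached i ->
    measurable_fun A f -> (forall x, A x -> 0 <= f x) ->
  (\int[prob (spaces P F tau i)]_(x in A) (f x)%:E =
   c%:E * \int[P]_(x in A) (f x)%:E)%E.
Proof.
move=> S; have [c c0 cE] := shifted_prob S; exists c => // A f mA AC mf f0.
have mC := measurable_reached (shifted_level S).
have -> : prob (spaces P F tau i) = mscale (NngNum (ltW c0)) (mrestr P mC).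
  by apply/funext => B; rewrite cE.
rewrite ge0_integral_mscale//.
- congr (_ * _)%E; apply: eq_measure_integral => B mB BA.
  by rewrite -[LHS]/(P (B `&` reached i)) (setIidl (subset_trans BA AC)).
- exact/measurable_EFinP.
Qed.

Lemma level_reached i n : level i.+1 n `<=` reached i.
Proof. by move=> x /totalS_inv[k [j [tk _ _]]]; rewrite /reached/= tk. Qed.

(** Such a set misses all other levels. These are the sets on which a local averaging identity is
    compared with one for [F n]. *)
Lemma stopped_sigma_sub_level i n A : shifted_space i -> F n A ->
  A `<=` level i.+1 n -> stopped_sigma (spaces P F tau i) (tau i) A.
Proof.
move=> S FA AL; apply/(stopped_sigmaE _ S); split; first exact: Fm FA.
  exact: subset_trans (@level_reached i n).
move=> l; have [->|ln] := eqVneq l n; first by rewrite (setIidl AL).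
have -> : A `&` level i.+1 l = set0; last exact: F0.
apply/seteqP; split => // x [/AL]; rewrite /level/= => -> [nl].
by rewrite nl eqxx in ln.
Qed.

Lemma stopped_measurable_level i n (u : T -> R) : shifted_space i ->
  (forall B : set R, measurable B -> stopped_sigma (spaces P F tau i) (tau i)
    (carrier (spaces P F tau i) `&` u @^-1` B)) ->
  measurable_fun (level i.+1 n : set (g_sigma_algebraType (F n))) u.
Proof.
move=> S mu _ B mB; apply/(sub_measurableE (sF n)).
have /(stopped_sigmaE _ S)[_ _ /(_ n)] := mu B mB.
rewrite (shifted_carrier S); congr (F _ _); apply/seteqP; split.
  by move=> x [[_ ux] Lx].
by move=> x [Lx ux]; split => //; split => //; exact: (@level_reached i n).
Qed.

Section Estop.
Variables (i n : nat) (h : T -> R).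
Hypothesis S : shifted_space i.
Hypothesis h0 : forall x, 0 <= h x.
Hypothesis mh : measurable_fun setT h.

Let L := level i.+1 n.

Let FL : F n L. Proof. exact: shifted_levelS. Qed.

Let mL : measurable (L : set (g_sigma_algebraType (F n))).
Proof. exact/(sub_measurableE (sF n)). Qed.

Let measurable_level (u : T -> R) :
  measurable_fun (L : set (g_sigma_algebraType (F n))) u -> measurable_fun L u.
Proof.
move=> mu _ B mB; apply: (Fm (n := n)); apply/(sub_measurableE (sF n)).
exact: mu.
Qed.

(** The part of the level where the chosen version is negative lies in [F n] and serves as test set.
    The default value 0 is harmless. *)
Lemma Estop_ge0 : {ae P, forall x, L x -> 0 <= Estop P F tau i h x}.
Proof.
rewrite /Estop /cond_exp.
case: xgetP => [u _ [mu _ uh]|nu]; last exact: aeW.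
have muL := @stopped_measurable_level i n u S mu.
pose A := L `&` [set x | u x < 0].
have AL : A `<=` L by move=> x [].
have FA : F n A.
  apply/(sub_measurableE (sF n)).
  have -> : A = L `&` (fun x => u x < 0) @^-1` [set true].
    by apply/seteqP; split => x [].
  by apply: (measurable_fun_ltr muL) => //; exact: measurable_cst.
have mA := Fm FA.
have muA : measurable_fun A u.
  exact: (measurable_funS (Fm FL) AL (measurable_level muL)).
have [c c0 cE] := integral_shifted_prob S.
have AC : A `<=` reached i by exact: subset_trans (@level_reached i n).
have := uh A (stopped_sigma_sub_level S FA AL).
rewrite [in RHS]cE//; last exact: measurable_funTS.
(* The formula for the scaled measure requires nonnegative integrands, while [u] is negative on
   [A]. *)
have -> : (\int[prob (spaces P F tau i)]_(x in A) (u x)%:E =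
    - \int[prob (spaces P F tau i)]_(x in A) (- u x)%:E)%E.
  have [k k0 kE] := shifted_prob S.
  have mC := measurable_reached (shifted_level S).
  have -> : prob (spaces P F tau i) = mscale (NngNum (ltW k0)) (mrestr P mC).
    by apply/funext => B; rewrite kE.
  rewrite -integral_ge0N.
    by apply: eq_integral => x _; rewrite -EFinN opprK.
  by move=> x [_ ux]; rewrite lee_fin oppr_ge0 ltW.
rewrite cE//; last 2 first.
- exact: measurable_funN.
- by move=> x [_ ux]; rewrite oppr_ge0 ltW.
move=> E.
have : (\int[P]_(x in A) `|(- u x)%:E| = 0)%E.
  under eq_integral.
    move=> x /[!inE] -[_ Ax]; rewrite gee0_abs ?lee_fin ?oppr_ge0 ?(ltW Ax)//; over.
  apply/eqP; rewrite eq_le; apply/andP; split; last first.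
    by apply: integral_ge0 => x [_ ux]; rewrite lee_fin oppr_ge0 ltW.
  rewrite -(@pmule_rle0 _ c%:E) ?lte_fin// -oppe_ge0 E mule_ge0 ?lee_fin ?(ltW c0)//.
  by apply: integral_ge0 => x _; rewrite lee_fin.
have mNu : measurable_fun A (fun x => (- u x)%:E).
  by apply/measurable_EFinP; exact: measurable_funN.
move/(ae_eq_integral_abs P mA mNu); apply: filterS => x H Lx.
rewrite leNgt; apply/negP => u0.
have /= := H (conj Lx u0); case => /eqP; rewrite oppr_eq0 => /eqP E0.
by move: u0; rewrite E0 ltxx.
Qed.

(** A genuine local version and [g] have equal integrals over the part of the level where [g] is
    exceeded, so that part is null. An inequality survives the default value 0 and suffices both for
    the operator and for the sparsity condition. *)
Lemma Estop_le_condexp (g : T -> R) : P.-integrable setT (EFin \o g) ->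
  measurable_fun (setT : set (g_sigma_algebraType (F n))) g -> (forall x, 0 <= g x) ->
  (forall A, F n A -> \int[P]_(x in A) (g x)%:E = \int[P]_(x in A) (h x)%:E)%E ->
  {ae P, forall x, L x -> Estop P F tau i h x <= g x}.
Proof.
move=> ig mg g0 gh; rewrite /Estop /cond_exp.
case: xgetP => [u _ [mu _ uh]|nu]; last first.
  by apply: aeW => x _; exact: g0.
have muL := @stopped_measurable_level i n u S mu.
pose A := L `&` [set x | g x < u x].
have AL : A `<=` L by move=> x [].
have FA : F n A.
  apply/(sub_measurableE (sF n)).
  have -> : A = L `&` (fun x => g x < u x) @^-1` [set true].
    by apply/seteqP; split => x [].
  have mgL : measurable_fun (L : set (g_sigma_algebraType (F n))) g.
    exact: measurable_funTS.
  by apply: (measurable_fun_ltr mgL muL).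
have mA := Fm FA.
have muA : measurable_fun A u.
  exact: (measurable_funS (Fm FL) AL (measurable_level muL)).
have u0A x : A x -> 0 <= u x by move=> [_ /ltW]; exact: le_trans.
have [c c0 cE] := integral_shifted_prob S.
have AC : A `<=` reached i by exact: subset_trans (@level_reached i n).
have uhA : (\int[P]_(x in A) (u x)%:E = \int[P]_(x in A) (g x)%:E)%E.
  have := uh A (stopped_sigma_sub_level S FA AL).
  rewrite !cE//; last exact: measurable_funTS.
  move=> /(congr1 (fun z => (c^-1)%:E * z)%E).
  by rewrite gh// !muleA -!EFinM mulVf ?gt_eqF// !mul1e.
have igA : P.-integrable A (EFin \o g) by exact: integrableS ig.
have iuA : P.-integrable A (EFin \o u).
  apply/integrableP; split; first exact/measurable_EFinP.
  under eq_integral => x /[!inE] Ax.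
    rewrite /= ger0_norm ?u0A//; over.
  rewrite uhA; have := integrable_fin_num mA igA.
  by rewrite /= ltey_eq => ->.
have muB : measurable_fun A (fun x => (u x - g x)%:E).
  apply/measurable_EFinP/measurable_funB => //; apply: measurable_funTS.
  exact: (sub_measurable_fun (sF n) (@Fm n)).
have : (\int[P]_(x in A) `|(u x - g x)%:E| = 0)%E.
  under eq_integral.
    move=> x /[!inE] -[_ Ax]; rewrite gee0_abs ?lee_fin ?subr_ge0 ?(ltW Ax)//.
    rewrite EFinB; over.
  rewrite integralB_EFin// uhA subee//; exact: integrable_fin_num igA.
move/(ae_eq_integral_abs P mA muB); apply: filterS => x H Lx.
rewrite leNgt; apply/negP => gu.
have /= := H (conj Lx gu); case => /eqP; rewrite subr_eq0 => /eqP E.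
by move: gu; rewrite E ltxx.
Qed.

End Estop.

End LocalSpaces.

(** * Conditional expectations on one level *)

Section Versions.
Context {d : measure_display} {T : measurableType d} {R : realType}.
Variable P : probability T R.

(** Conditional expectation as a relation rather than a choice, nonnegative everywhere; a convenient
    version, such as a strictly positive one, can then be picked. *)
Definition version (G : set (set T)) (f g : T -> R) : Prop :=
  [/\ measurable_fun (setT : set (g_sigma_algebraType G)) g, forall x, 0 <= g x,
      P.-integrable setT (EFin \o g) &
      forall A, G A -> (\int[P]_(x in A) (g x)%:E = \int[P]_(x in A) (f x)%:E)%E].

Lemma measurable_fun_inv d' (U : measurableType d') (D : set U) (f : U -> R) :
  (forall x, 0 <= f x) -> measurable_fun D f -> measurable_fun D (fun x => (f x)^-1).
Proof.
move=> f0 mf; have -> : (fun x => (f x)^-1) = (fun x => f x `^ (-1)).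
  by apply/funext => x; rewrite powR_inv1.
exact: measurable_fun_powR.
Qed.

Section OneAlgebra.
Variable G : set (set T).
Hypothesis sG : sigma_algebra setT G.
Hypothesis Gm : G `<=` measurable.
Local Notation TG := (g_sigma_algebraType G).

Lemma version_measurable f g : version G f g -> measurable_fun setT g.
Proof. by case=> mg _ _ _; exact: (sub_measurable_fun sG Gm). Qed.

Lemma integralM_version (f g Z : T -> R) : measurable_fun setT f -> (forall x, 0 <= f x) ->
  version G f g -> measurable_fun (setT : set TG) (Z : TG -> R) ->
  (forall x, 0 <= Z x) ->
  (\int[P]_x (Z x * f x)%:E = \int[P]_x (Z x * g x)%:E)%E.
Proof.
move=> mf f0 vg mZ Z0; have [_ g0 _ E] := vg.
apply: (eq_integralM_sub sG Gm) => //; first exact: version_measurable vg.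
by move=> A GA; rewrite E.
Qed.

Lemma version_ae_eq f g1 g2 : version G f g1 -> version G f g2 ->
  {ae P, forall x, g1 x = g2 x}.
Proof.
move=> [m1 _ i1 E1] [m2 _ i2 E2].
have le12 : {ae P, forall x, g1 x <= g2 x}.
  by apply: (ae_le_of_sub_integral sG Gm) => // A GA; rewrite E1// E2.
have le21 : {ae P, forall x, g2 x <= g1 x}.
  by apply: (ae_le_of_sub_integral sG Gm) => // A GA; rewrite E1// E2.
by apply: filterS2 le12 le21 => x ? ?; apply/eqP; rewrite eq_le; apply/andP.
Qed.

Lemma exists_version (f : T -> R) : (forall x, 0 <= f x) -> P.-integrable setT (EFin \o f) ->
  exists g, version G f g.
Proof. by move=> f0 /(exists_condexp sG Gm f0)[g gP]; exists g. Qed.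

(** The zero set of a version is in [G] and the positive [f] has integral zero over it, so it is
    null; adding its indicator makes division possible. *)
Lemma exists_pos_version (f : T -> R) : (forall x, 0 < f x) -> P.-integrable setT (EFin \o f) ->
  exists2 g, version G f g & forall x, 0 < g x.
Proof.
move=> f0 intf; have [g vg] := exists_version (fun x => ltW (f0 x)) intf.
have [mg g0 ig Eg] := vg.
pose N := g @^-1` [set 0].
have mN : measurable (N : set TG) by rewrite -[N]setTI; exact: mg.
have GN : G N by apply/(sub_measurableE sG).
have N0 : P N = 0%E.
  have mfN : measurable_fun N (EFin \o f).
    by apply: measurable_funTS; exact: measurable_int intf.
  have : (\int[P]_(x in N) `|(EFin \o f) x| = 0)%E.
    under eq_integral do rewrite /= ger0_norm ?(ltW (f0 _))//.
    rewrite -Eg// integral0_eq// => x; rewrite /N/= => -> //.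
  move/(ae_eq_integral_abs P (Gm GN) mfN) => [N' [mN' N'0 sN']].
  apply: (subset_measure0 (B := N')) => //; first exact: Gm.
  by move=> x Nx; apply: sN' => /= /(_ Nx) -[] fx; have := f0 x; rewrite fx ltxx.
pose g' x := g x + \1_N x.
have m1N : measurable_fun (setT : set TG) (\1_N : TG -> R) by exact: measurable_indic.
exists g'; last first.
  move=> x; rewrite /g' indicE; have [Nx|Nx] := pselect (N x).
    by rewrite mem_set// ltr_wpDl.
  rewrite memNset// addr0 lt_def g0 andbT; apply/eqP => gx; exact: Nx.
have i1N : P.-integrable setT (EFin \o (\1_N : T -> R)).
  by apply: integrable_indic => //; exact: Gm.
split.
- exact: measurable_funD.
- by move=> x; rewrite addr_ge0.
- exact: (integrableD measurableT ig i1N).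
- move=> A GA; rewrite -Eg//; apply: ae_eq_integral.
  + exact: Gm.
  + apply/measurable_EFinP/measurable_funTS; apply: (sub_measurable_fun sG Gm).
    exact: measurable_funD.
  + apply/measurable_EFinP/measurable_funTS; exact: (sub_measurable_fun sG Gm).
  + exists N; split => //; first exact: Gm.
    move=> x /= H; apply: contrapT => Nx; apply: H => _.
    by rewrite /g' indicE memNset// addr0.
Qed.

Lemma integrable_ge0 (f : T -> R) : measurable_fun setT f -> (forall x, 0 <= f x) ->
  (\int[P]_x (f x)%:E < +oo)%E -> P.-integrable setT (EFin \o f).
Proof.
move=> mf f0 fy; apply/integrableP; split; first exact/measurable_EFinP.
by under eq_integral do rewrite /= ger0_norm//.
Qed.

(* Conditional Chebyshev: at most a fraction 1/(2K) of each part of [D] lies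
   where [u >= 2K E(u | G)], so half of the mass that [S] has in [D] survives. *)
Lemma sparse_chebyshev (K : R) (D S : set T) (u c e : T -> R) :
  1 <= K -> G D -> measurable S ->
  (forall x, 0 < u x) -> P.-integrable setT (EFin \o u) ->
  version G u c -> (forall x, 0 < c x) -> version G (\1_S) e ->
  {ae P, forall x, D x -> 1 <= K * e x} ->
  forall A, G A -> (\int[P]_(x in A) (\1_D x)%:E <=
    \int[P]_(x in A) (2 * K * \1_(D `&` S `&` [set x | u x < 2 * K * c x]) x)%:E)%E.
Proof.
move=> K1 GD mS u0 iu vc c0 ve De A GA.
have K0 : 0 < K by lra.
have [mc _ ic Ec] := vc; have [me e0 ie Ee] := ve.
have mu : measurable_fun setT u by apply/measurable_EFinP; exact: measurable_int iu.
have mc' := version_measurable vc.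
have me' := version_measurable ve.
have mD := Gm GD; have mA := Gm GA.
set V := [set x | u x < 2 * K * c x].
have mV : measurable V.
  have -> : V = setT `&` (fun x => u x < 2 * K * c x) @^-1` [set true].
    by apply/seteqP; split => x //= -[].
  by apply: (measurable_fun_ltr mu) => //; exact: measurable_funM.
pose B := A `&` D.
have GB : G B.
  by apply/(sub_measurableE sG); apply: measurableI; apply/(sub_measurableE sG).
have mB := Gm GB.
have step1 : (P B <= K%:E * P (B `&` S))%E.
  rewrite setIC -(integral_indic P mB mS) -Ee//.
  rewrite integral_in_indic -ge0_integralZl_real ?(ltW K0)//; last 2 first.
  - by apply: measurable_funM => //; exact: measurable_indic.
  - by move=> x; rewrite mulr_ge0.
  rewrite -[in P B](setIT B) -(integral_indic P measurableT mB).
  apply: ae_ge0_le_integral_EFin.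
  - exact: measurable_indic.
  - by apply: measurable_funM => //; apply: measurable_funM => //; exact: measurable_indic.
  - by move=> x.
  - by move=> x; rewrite !mulr_ge0// ltW.
  - apply: filterS De => x De; rewrite indicE.
    have [Bx|Bx] := pselect (B x); last by rewrite memNset// mul0r mulr0.
    by rewrite mem_set// mul1r; apply: De; case: Bx.
(* Off [V] the product of [1_B / (2 K c)] and [u] is at least 1 on [B]; the first factor is
   [G]-measurable, so [u] may be replaced by [c] under the integral. *)
have step2 : (P (B `\` V) <= (2 * K)^-1%:E * P B)%E.
  have mZ : measurable_fun (setT : set TG) (fun x => \1_B x * (2 * K * c x)^-1).
    apply: measurable_funM; first by apply: measurable_indic; apply/(sub_measurableE sG).
    apply: measurable_fun_inv; first by move=> x; rewrite !mulr_ge0// ltW.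
    exact: measurable_funM.
  have Z0 x : 0 <= \1_B x * (2 * K * c x)^-1.
    by rewrite mulr_ge0// invr_ge0 !mulr_ge0// ltW.
  have mBV : measurable (B `\` V) by exact: measurableD.
  apply: (@le_trans _ _ (\int[P]_x (\1_B x * (2 * K * c x)^-1 * u x)%:E)%E).
    rewrite -[in P _](setIT (B `\` V)) -(integral_indic P measurableT mBV).
    apply: ge0_le_integral_EFin.
    - exact: measurable_indic.
    - apply: measurable_funM => //; exact: (sub_measurable_fun sG Gm).
    - by move=> x.
    - move=> x; rewrite indicE; have [[Bx nV]|BVx] := pselect ((B `\` V) x); last first.
        by rewrite memNset// mulr_ge0// ltW.
      rewrite mem_set// indicE mem_set// mul1r mulrC ler_pdivlMr.
        by rewrite mul1r leNgt; apply/negP.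
      by rewrite !mulr_gt0.
  rewrite (integralM_version mu (fun x => ltW (u0 x)) vc mZ Z0).
  rewrite -[in P B](setIT B) -(integral_indic P measurableT mB).
  rewrite -ge0_integralZl_real//; last by rewrite invr_ge0 mulr_ge0// ltW.
  rewrite le_eqVlt; apply/orP; left; apply/eqP; apply: eq_integral => x _.
  congr (_%:E); field; rewrite !gt_eqF//.
have mBS : measurable (B `&` S) by exact: measurableI.
have mBSV : measurable (B `&` S `&` V) by exact: measurableI.
have step3 : (P (B `&` S) <= P (B `&` S `&` V) + P (B `\` V))%E.
  apply: (le_trans _ (measureU2 _ mBSV (measurableD mB mV))).
  apply: le_measure; rewrite ?inE//.
    by apply: measurableU => //; exact: measurableD.
  move=> x [Bx Sx]; have [Vx|Vx] := pselect (V x); [left|right]; by split.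
have mDSV : measurable (D `&` S `&` V) by apply: measurableI => //; exact: measurableI.
rewrite integral_indic//.
have -> : (\int[P]_(x in A) (2 * K * \1_(D `&` S `&` V) x)%:E =
    (2 * K)%:E * P (B `&` S `&` V))%E.
  rewrite integral_in_indic.
  under eq_integral do rewrite mulrCA.
  rewrite ge0_integralZl_real; last 3 first.
  - by apply: measurable_funM; exact: measurable_indic.
  - by move=> x; rewrite mulr_ge0.
  - by rewrite mulr_ge0// ltW.
  rewrite -integral_in_indic integral_indic//; congr (_ * P _)%E.
  by rewrite /B setIC !setIA.
rewrite setIC -/B.
move: step1 step2 step3.
rewrite -(fineK (fin_num_measure P _ mB)) -(fineK (fin_num_measure P _ mBS)).
rewrite -(fineK (fin_num_measure P _ mBSV)).
rewrite -(fineK (fin_num_measure P _ (measurableD mB mV))).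
rewrite -!EFinM -EFinD !lee_fin.
set b := fine (P B); set s := fine _; set t := fine _; set v := fine _ => h1 h2 h3.
(* The loss outside [V] costs at most half of [P B]; absorbing that half turns [K] into [2 K]. *)
have : K * s <= K * (v + t) by rewrite ler_pM2l.
have : K * t <= b / 2.
  have -> : b / 2 = K * ((2 * K)^-1 * b) by field; rewrite gt_eqF.
  by rewrite ler_pM2l.
rewrite -[X in (X <= _)%E](fineK (fin_num_measure P _ mB)) lee_fin -/b mulrDr.
lra.
Qed.

(** In the constant, [M] comes from the mixed condition, [2 K] from the mass comparison, and
    [(2 K)^kappa] from replacing the average [c] by [u] where [u < 2 K c]. *)
Lemma level_estimate (K M kappa : R) (D S : set T) (h psi w s u v a b c e y x0 : T -> R) :
  1 <= K -> 0 <= M -> 0 <= kappa -> G D -> measurable S ->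
  (forall x, 0 <= psi x * w x) -> P.-integrable setT (EFin \o (fun x => psi x * w x)) ->
  (forall x, 0 < u x) -> P.-integrable setT (EFin \o u) ->
  (forall x, u x `^ (- kappa) = v x) ->
  version G w a -> (forall x, 0 < a x) ->
  version G s b -> (forall x, 0 < b x) ->
  version G u c -> (forall x, 0 < c x) ->
  version G (\1_S) e -> version G h y -> version G (fun x => psi x * w x) x0 ->
  {ae P, forall x, D x -> 1 <= K * e x} ->
  {ae P, forall x, a x * b x * c x `^ kappa <= M} ->
  (\int[P]_x (\1_D x * y x * (psi x * w x))%:E <=
   (M * (2 * K) * (2 * K) `^ kappa)%:E *
     \int[P]_x (\1_(D `&` S) x * (x0 x / a x * (y x / b x) * v x))%:E)%E.
Proof.
move=> K1 M0 k0 GD mS pw0 ipw u0 iu uv va a0 vb b0 vc c0 ve vy vx De abc.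
have K0 : 0 < K by lra.
have [ma _ _ _] := va; have [mb _ _ _] := vb; have [mc _ _ _] := vc.
have [my y0 _ _] := vy; have [mx x00 _ _] := vx.
have mpw : measurable_fun setT (fun x => psi x * w x).
  by apply/measurable_EFinP; exact: measurable_int ipw.
have mu : measurable_fun setT u by apply/measurable_EFinP; exact: measurable_int iu.
have mv : measurable_fun setT v.
  have -> : v = (fun x => u x `^ (- kappa)) by apply/funext => x; rewrite uv.
  exact: measurable_fun_powR.
have v0 x : 0 <= v x by rewrite -uv powR_ge0.
have mD := Gm GD.
have mGD : measurable (D : set TG) by apply/(sub_measurableE sG).
have m1D : measurable_fun (setT : set TG) (\1_D : TG -> R) by exact: measurable_indic.
rewrite (integralM_version mpw pw0 vx); last 2 first.
- exact: measurable_funM.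
- by move=> x; rewrite mulr_ge0.
pose xy x := x0 x / a x * (y x / b x).
have xy0 x : 0 <= xy x by rewrite !mulr_ge0// ?invr_ge0 ltW.
have mxy : measurable_fun (setT : set TG) (xy : TG -> R).
  by apply: measurable_funM; apply: measurable_funM => //; apply: measurable_fun_inv => // x;
    rewrite ltW.
have mxy' : measurable_fun setT xy by exact: (sub_measurable_fun sG Gm).
pose Z x := M * xy x * c x `^ (- kappa).
have Z0 x : 0 <= Z x.
  by apply: mulr_ge0 (powR_ge0 _ _); exact: mulr_ge0 (xy0 x).
have mZ : measurable_fun (setT : set TG) (Z : TG -> R).
  by apply: measurable_funM; [exact: measurable_funM|exact: measurable_fun_powR].
have mZ' : measurable_fun setT Z by exact: (sub_measurable_fun sG Gm).
apply: (@le_trans _ _ (\int[P]_x (Z x * \1_D x)%:E)%E).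
  apply: ae_ge0_le_integral_EFin.
  - by apply: (sub_measurable_fun sG Gm); apply: measurable_funM => //; exact: measurable_funM.
  - by apply: measurable_funM => //; exact: measurable_indic.
  - by move=> x; rewrite !mulr_ge0.
  - by move=> x; rewrite mulr_ge0.
  - apply: filterS abc => x abc; rewrite mulrC mulrA [Z x * _]mulrC.
    have -> : x0 x * \1_D x * y x = \1_D x * (xy x * (a x * b x)).
      by rewrite /xy; field; rewrite !gt_eqF.
    have -> : Z x = xy x * (M * c x `^ (- kappa)) by rewrite /Z; ring.
    apply: ler_wpM2l => //; apply: ler_wpM2l => //.
    by rewrite powRN ler_pdivlMr// powR_gt0.
set V := [set x | u x < 2 * K * c x].
have mV : measurable V.
  have -> : V = setT `&` (fun x => u x < 2 * K * c x) @^-1` [set true].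
    by apply/seteqP; split => x //= -[].
  apply: (measurable_fun_ltr mu) => //; apply: measurable_funM => //.
  exact: (sub_measurable_fun sG Gm).
have mDS : measurable (D `&` S) by exact: measurableI.
have mDSV : measurable (D `&` S `&` V) by exact: measurableI.
(* [sparse_chebyshev] compares masses on sets of [G] only; this is enough because [Z] is
   [G]-measurable. *)
apply: (@le_trans _ _ (\int[P]_x (Z x * (2 * K * \1_(D `&` S `&` V) x))%:E)%E).
  apply: (le_integralM_sub sG Gm) => //.
  - by apply: measurable_funM => //; exact: measurable_indic.
  - by move=> x; rewrite !mulr_ge0// ltW.
  - exact: (sparse_chebyshev K1 GD mS u0 iu vc c0 ve De).
have mE : measurable_fun setT (fun x => \1_(D `&` S) x * (xy x * v x)).
  by apply: measurable_funM; [exact: measurable_indic|exact: measurable_funM].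
have E0 x : 0 <= \1_(D `&` S) x * (xy x * v x).
  by apply: mulr_ge0 => //; exact: mulr_ge0.
have K2 : 0 <= 2 * K by rewrite mulr_ge0// ltW.
have C0 : 0 <= M * (2 * K) * (2 * K) `^ kappa.
  by apply: mulr_ge0 (powR_ge0 _ _); exact: mulr_ge0.
rewrite -ge0_integralZl_real//.
apply: ge0_le_integral_EFin.
- by apply: measurable_funM => //; apply: measurable_funM => //; exact: measurable_indic.
- exact: measurable_funM.
- by move=> x; apply: mulr_ge0 => //; exact: mulr_ge0.
- move=> x; rewrite indicE; have [[DSx Vx]|nx] := pselect ((D `&` S `&` V) x); last first.
    by rewrite memNset// !mulr0; exact: mulr_ge0.
  rewrite mem_set// indicE mem_set// mulr1 mul1r.
  have ck : c x `^ (- kappa) <= (2 * K) `^ kappa * v x.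
    rewrite -uv !powRN ler_pdivlMr ?powR_gt0// mulrC ler_pdivrMr ?powR_gt0//.
    rewrite -powRM ?mulr_ge0// ?(ltW K0)// ?(ltW (c0 x))//.
    by rewrite ge0_ler_powR// ?nnegrE ?mulr_ge0 ?(ltW (u0 x)) ?(ltW K0) ?(ltW (c0 x))// ltW.
  rewrite /Z -/(xy x).
  have -> : M * xy x * c x `^ (- kappa) * (2 * K) =
    (M * (2 * K) * xy x) * c x `^ (- kappa) by ring.
  have -> : M * (2 * K) * (2 * K) `^ kappa * (xy x * v x) =
    (M * (2 * K) * xy x) * ((2 * K) `^ kappa * v x) by ring.
  by apply: ler_wpM2l => //; apply: mulr_ge0 => //; exact: mulr_ge0.
Qed.

End OneAlgebra.
End Versions.

(** * Sums over the levels *)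

Section SparseSums.
Context {d : measure_display} {T : measurableType d} {R : realType}.
Variables (P : probability T R) (F : nat -> set (set T)).
Hypothesis sF : forall n, sigma_algebra setT (F n).
Hypothesis Fm : forall n, F n `<=` measurable.
Hypothesis Fmono : forall m n, (m <= n)%N -> F m `<=` F n.

(** The quotient of [E(g w | F n)] by [E(w | F n)] is the conditional expectation of [g] under
    [w dP], the input of [doob_running_max]. *)
Lemma version_ratio n (g w a x : T -> R) :
  measurable_fun setT w -> (forall t, 0 < w t) ->
  version P (F n) w a -> (forall t, 0 < a t) -> version P (F n) (fun t => g t * w t) x ->
  [/\ measurable_fun (setT : set (g_sigma_algebraType (F n))) (fun t => x t / a t),
      forall t, 0 <= x t / a t &
      forall A, F n A -> (\int[P]_(t in A) (x t / a t * w t)%:E =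
                         \int[P]_(t in A) (g t * w t)%:E)%E].
Proof.
move=> mw w0 va a0 vx.
have [ma _ _ _] := va; have [mx x0 _ Ex] := vx.
have mxa : measurable_fun (setT : set (g_sigma_algebraType (F n))) (fun t => x t / a t).
  by apply: measurable_funM => //; apply: measurable_fun_inv => // t; exact: ltW.
have xa0 t : 0 <= x t / a t by rewrite divr_ge0// ltW.
split; [exact: mxa|exact: xa0|move=> A FA].
transitivity (\int[P]_(t in A) (x t)%:E)%E; last exact: Ex.
rewrite !(integral_in_indic P A).
under eq_integral do rewrite mulrA.
rewrite (integralM_version (sF n) (@Fm n) mw (fun t => ltW (w0 t)) va).
- apply: eq_integral => t _; congr (_%:E); rewrite -mulrA divfK//.
  by rewrite gt_eqF.
- apply: measurable_funM => //; apply: measurable_indic.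
  exact/(sub_measurableE (sF n)).
- by move=> t; rewrite mulr_ge0.
Qed.

Lemma sum_disjoint_indic_le (J : finType) (A : J -> set T) (f : J -> R) (B : R) (t : T) :
  (forall i j, A i t -> A j t -> i = j) -> 0 <= B ->
  (forall i, A i t -> f i <= B) ->
  \sum_(i : J) \1_(A i) t * f i <= B.
Proof.
move=> dA B0 fB; have [[i Ai]|nA] := pselect (exists i, A i t); last first.
  rewrite big1// => i _; rewrite indicE memNset ?mul0r// => Ai.
  by apply: nA; exists i.
rewrite (bigD1 i)//= [X in _ + X]big1 ?addr0; last first.
  move=> j ji; rewrite indicE memNset ?mul0r// => Aj.
  by rewrite (dA _ _ Aj Ai) eqxx in ji.
by rewrite indicE mem_set// mul1r; exact: fB.
Qed.

(** Keeping both indices below [n0] makes sums and maxima finite, with a bound free of [n0]. Doob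
    applies to [psi] in [L^q(w)] and to [h / s] in [L^p(s)], because [psi^q = phi^p] and
    [(h / s)^p s = h^p w]. *)
Lemma sparse_sum_estimate (p q K M kappa : R) (w s u v h : T -> R)
    (D : nat -> nat -> set T) (S : nat -> set T) (y : nat -> T -> R) (n0 : nat) :
  1 < p -> 1 < q -> p^-1 + q^-1 = 1 -> 1 <= K -> 0 <= M -> 0 <= kappa ->
  (forall t, 0 < w t) -> P.-integrable setT (EFin \o w) ->
  (forall t, 0 < s t) -> P.-integrable setT (EFin \o s) ->
  (forall t, 0 < u t) -> P.-integrable setT (EFin \o u) ->
  (forall t, u t `^ (- kappa) = v t) ->
  (forall t, v t = w t `^ q^-1 * s t `^ p^-1) ->
  (forall t, s t `^ (1 - p) = w t) ->
  (forall i n, F n (D i n)) -> (forall i, measurable (S i)) ->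
  (forall t i n j m, (D i n `&` S i) t -> (D j m `&` S j) t -> i = j /\ n = m) ->
  (forall i n e, version P (F n) (\1_(S i)) e ->
    {ae P, forall t, D i n t -> 1 <= K * e t}) ->
  (forall n a b c, version P (F n) w a -> version P (F n) s b ->
    version P (F n) u c -> {ae P, forall t, a t * b t * c t `^ kappa <= M}) ->
  (forall t, 0 <= h t) -> measurable_fun setT h ->
  (forall n, version P (F n) h (y n)) ->
  (\int[P]_t (h t `^ p * w t)%:E < +oo)%E ->
  (\int[P]_t ((\sum_(k : 'I_n0 * 'I_n0) \1_(D k.1 k.2) t * y k.2 t) `^ p * w t)%:E <=
   ((M * (2 * K) * (2 * K) `^ kappa * (p * q)) `^ p)%:E *
     \int[P]_t (h t `^ p * w t)%:E)%E.
Proof.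
move=> p1 q1 pq K1 M0 k0 w0 iw s0 ins u0 iu uv vE sw FD mS dis sparse mixed h0 mh vy hfin.
have [p0 q0] : 0 < p /\ 0 < q by split; lra.
have qp : q^-1 + p^-1 = 1 by rewrite addrC.
have p10 : 0 <= p - 1 by lra.
have K0 : 0 < K by lra.
have pE := conjugate_exponentM p0 q0 pq.
have mw : measurable_fun setT w by apply/measurable_EFinP; exact: measurable_int iw.
have ms : measurable_fun setT s by apply/measurable_EFinP; exact: measurable_int ins.
have mu : measurable_fun setT u by apply/measurable_EFinP; exact: measurable_int iu.
have mv : measurable_fun setT v.
  have -> : v = (fun x => u x `^ (- kappa)) by apply/funext => x; rewrite uv.
  exact: measurable_fun_powR.
have v0 t : 0 <= v t by rewrite -uv powR_ge0.
have w0' t : 0 <= w t by exact: ltW.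
have y0 n t : 0 <= y n t by have [_ + _ _] := vy n; exact.
have my n : measurable_fun setT (y n) by exact: version_measurable (vy n).
have mD i n : measurable (D i n) by exact: Fm (FD i n).
pose U t := \sum_(k : 'I_n0 * 'I_n0) \1_(D k.1 k.2) t * y k.2 t.
have U0 t : 0 <= U t by apply: sumr_ge0 => k _; rewrite mulr_ge0.
have mDy (k : 'I_n0 * 'I_n0) : measurable_fun setT (fun t => \1_(D k.1 k.2) t * y k.2 t).
  by apply: measurable_funM => //; exact: measurable_indic.
have mU : measurable_fun setT U by apply: measurable_sum => k.
apply: integral_truncated_le => // N.
pose phi t := Num.min (U t) N%:R.
have phi0 t : 0 <= phi t by rewrite le_min U0/=.
have mphi : measurable_fun setT phi by exact: measurable_minr.
pose psi t := phi t `^ (p - 1).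
have psi0 t : 0 <= psi t by exact: powR_ge0.
have mpsi : measurable_fun setT psi by exact: measurable_fun_powR.
have mpw : measurable_fun setT (fun t => psi t * w t) by exact: measurable_funM.
have pw0 t : 0 <= psi t * w t by exact: mulr_ge0.
have wfin : (\int[P]_t (w t)%:E)%E \is a fin_num by exact: integrable_fin_num iw.
(* Exponent [p] gives the finiteness of [B], exponent [p - 1] the integrability of [psi w]. *)
have bnd (r : R) : 0 <= r -> (\int[P]_t (phi t `^ r * w t)%:E < +oo)%E.
  move=> r0; apply: (@le_lt_trans _ _ (\int[P]_x (N%:R `^ r * w x)%:E)%E).
    apply: ge0_le_integral_EFin.
    - by apply: measurable_funM => //; exact: measurable_fun_powR.
    - exact: measurable_funM.
    - by move=> x; rewrite mulr_ge0 ?powR_ge0.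
    - move=> x; rewrite ler_wpM2r// ge0_ler_powR ?nnegrE//.
      by rewrite /phi ge_min lexx orbT.
  by rewrite ge0_integralZl_real ?powR_ge0// -(fineK wfin) -EFinM ltry.
have ipw : P.-integrable setT (EFin \o (fun t => psi t * w t)).
  exact: (integrable_ge0 mpw pw0 (bnd _ p10)).
have /choice[a Ha] : forall n, exists a, version P (F n) w a /\ forall t, 0 < a t.
  by move=> n; have [a ? ?] := exists_pos_version (sF n) (@Fm n) w0 iw; exists a.
have /choice[b Hb] : forall n, exists b, version P (F n) s b /\ forall t, 0 < b t.
  by move=> n; have [b ? ?] := exists_pos_version (sF n) (@Fm n) s0 ins; exists b.
have /choice[c Hc] : forall n, exists c, version P (F n) u c /\ forall t, 0 < c t.
  by move=> n; have [c ? ?] := exists_pos_version (sF n) (@Fm n) u0 iu; exists c.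
have /choice[x0 Hx] : forall n, exists x, version P (F n) (fun t => psi t * w t) x.
  by move=> n; exact: (exists_version (sF n) (@Fm n) pw0 ipw).
pose X n t := x0 n t / a n t.
pose Y n t := y n t / b n t.
have HX n := version_ratio mw w0 (Ha n).1 (Ha n).2 (Hx n).
have HY n : [/\ measurable_fun (setT : set (g_sigma_algebraType (F n))) (Y n),
    forall t, 0 <= Y n t &
    forall A, F n A -> (\int[P]_(t in A) (Y n t * s t)%:E =
                         \int[P]_(t in A) (h t / s t * s t)%:E)%E].
  apply: (version_ratio ms s0 (Hb n).1 (Hb n).2).
  suff -> : (fun t => h t / s t * s t) = h by [].
  by apply/funext => t; rewrite divfK// gt_eqF.
pose XX := running_max X n0; pose YY := running_max Y n0.
have X0 n t : 0 <= X n t by have [_ + _] := HX n; exact.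
have Y0 n t : 0 <= Y n t by have [_ + _] := HY n; exact.
have XX0 t : 0 <= XX t by apply: (le_trans (X0 0%N t)); exact: running_max_ge.
have YY0 t : 0 <= YY t by apply: (le_trans (Y0 0%N t)); exact: running_max_ge.
have mXn n : measurable_fun (setT : set (g_sigma_algebraType (F n))) (X n).
  by have [] := HX n.
have mYn n : measurable_fun (setT : set (g_sigma_algebraType (F n))) (Y n).
  by have [] := HY n.
have mX n : measurable_fun setT (X n) by exact: (sub_measurable_fun (sF n) (@Fm n)).
have mY n : measurable_fun setT (Y n) by exact: (sub_measurable_fun (sF n) (@Fm n)).
have mXX : measurable_fun setT XX.
  apply: (sub_measurable_fun (sF n0) (@Fm n0)); exact: measurable_running_max.
have mYY : measurable_fun setT YY.
  apply: (sub_measurable_fun (sF n0) (@Fm n0)); exact: measurable_running_max.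
set C1 := M * (2 * K) * (2 * K) `^ kappa.
have C10 : 0 <= C1.
  by apply: mulr_ge0 (powR_ge0 _ _); apply: mulr_ge0 => //; apply: mulr_ge0 => //; exact: ltW.
set B := (\int[P]_t (phi t `^ p * w t)%:E)%E.
set H := (\int[P]_t (h t `^ p * w t)%:E)%E.
have Bfin : (B < +oo)%E by apply: bnd; exact: ltW.
have B0 : (0 <= B)%E.
  by apply: integral_ge0 => t _; rewrite lee_fin mulr_ge0 ?powR_ge0.
have H0 : (0 <= H)%E.
  by apply: integral_ge0 => t _; rewrite lee_fin mulr_ge0 ?powR_ge0.
have est1 : (B <= C1%:E * \int[P]_t (XX t * YY t * (w t `^ q^-1 * s t `^ p^-1))%:E)%E.
  apply: (@le_trans _ _ (\int[P]_t (\sum_(k : 'I_n0 * 'I_n0)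
      \1_(D k.1 k.2) t * y k.2 t * (psi t * w t))%:E)%E).
    apply: ge0_le_integral_EFin.
    - by apply: measurable_funM => //; exact: measurable_fun_powR.
    - by apply: measurable_sum => k; exact: measurable_funM.
    - by move=> t; rewrite mulr_ge0 ?powR_ge0.
    - move=> t; rewrite -mulr_suml -/(U t) mulrA ler_wpM2r//.
      rewrite -(mulr_powRB1 (phi0 t) p0) ler_wpM2r ?powR_ge0//.
      by rewrite /phi ge_min lexx.
  rewrite ge0_integral_sum_real; last 2 first.
  - by move=> k; exact: measurable_funM.
  - by move=> k t; apply: mulr_ge0 => //; exact: mulr_ge0.
  apply: (@le_trans _ _ (\sum_(k : 'I_n0 * 'I_n0) C1%:E *
     \int[P]_t (\1_(D k.1 k.2 `&` S k.1) t * (X k.2 t * Y k.2 t * v t))%:E)%E).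
    apply: lee_sum => k _.
    have i1S : P.-integrable setT (EFin \o (\1_(S k.1) : T -> R)).
      exact: integrable_indic.
    have [e ve] := exists_version (sF k.2) (@Fm k.2) (fun t => ler0n _ _) i1S.
    have [va a0] := Ha k.2; have [vb b0] := Hb k.2; have [vc c0] := Hc k.2.
    exact: (level_estimate (sF k.2) (@Fm k.2) K1 M0 k0 (FD _ _) (mS _) pw0 ipw u0 iu uv
      va a0 vb b0 vc c0 ve (vy _) (Hx _) (sparse _ _ _ ve) (mixed _ _ _ _ va vb vc)).
  have XYv0 n t : 0 <= X n t * Y n t * v t by apply: mulr_ge0 => //; exact: mulr_ge0.
  have mXYv n : measurable_fun setT (fun t => X n t * Y n t * v t).
    by apply: measurable_funM => //; exact: measurable_funM.
  have mterm (k : 'I_n0 * 'I_n0) : measurable_fun setT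
     (fun t => \1_(D k.1 k.2 `&` S k.1) t * (X k.2 t * Y k.2 t * v t)).
    apply: measurable_funM => //; apply: measurable_indic; exact: measurableI.
  rewrite -ge0_sume_distrr; last first.
    by move=> k _; apply: integral_ge0 => t _; rewrite lee_fin mulr_ge0.
  apply: lee_wpmul2l; first by rewrite lee_fin.
  rewrite -ge0_integral_sum_real//; last by move=> k t; rewrite mulr_ge0.
  apply: ge0_le_integral_EFin.
  - exact: measurable_sum.
  - apply: measurable_funM; first exact: measurable_funM.
    by apply: measurable_funM; exact: measurable_fun_powR.
  - by move=> t; apply: sumr_ge0 => k _; rewrite mulr_ge0.
  (* Within the sparse parts the levels are disjoint, so at most one term is left at each point and
     summation costs nothing. *)
  - move=> t; rewrite -vE; apply: sum_disjoint_indic_le.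
    + move=> [i n] [j m] /= DSi DSj; have [ij nm] := dis _ _ _ _ _ DSi DSj.
      by congr pair; exact: val_inj.
    + by apply: mulr_ge0 => //; exact: mulr_ge0.
    + move=> k _; apply: ler_wpM2r => //; apply: ler_pM => //.
      * by apply: running_max_ge; exact: ltnW.
      * by apply: running_max_ge; exact: ltnW.
have est2 : (\int[P]_t (XX t `^ q * w t)%:E <= (p `^ q)%:E * B)%E.
  have <- : (\int[P]_t (psi t `^ q * w t)%:E = B)%E.
    by apply: eq_integral => t _; rewrite /psi -powRrM pE.
  have HXA n A : F n A -> (\int[P]_(t in A) (X n t * w t)%:E =
      \int[P]_(t in A) (psi t * w t)%:E)%E.
    by have [_ _ HXn] := HX n; exact: HXn.
  exact: (@doob_running_max _ _ _ P F sF Fm Fmono X psi w q p n0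
    mXn X0 mpsi psi0 iw w0 HXA q1 p0 qp).
have est3 : (\int[P]_t (YY t `^ p * s t)%:E <= (q `^ p)%:E * H)%E.
  have <- : (\int[P]_t ((h t / s t) `^ p * s t)%:E = H)%E.
    apply: eq_integral => t _; congr (_%:E).
    rewrite powRM ?invr_ge0// ?(ltW (s0 t))// -mulrA; congr (_ * _).
    have -> : w t = s t / s t `^ p.
      rewrite -sw powRB; first by rewrite powRr1// ltW.
      by rewrite [s t == 0]gt_eqF// implybT.
    rewrite mulrC; congr (_ * _).
    by rewrite -powR_inv1 ?(ltW (s0 t))// -powRrM mulN1r powRN.
  have mhs : measurable_fun setT (fun t => h t / s t).
    by apply: measurable_funM => //; apply: measurable_fun_inv => // t; exact: ltW.
  have hs0 t : 0 <= h t / s t by rewrite divr_ge0// ltW.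
  have HYA n A : F n A -> (\int[P]_(t in A) (Y n t * s t)%:E =
      \int[P]_(t in A) (h t / s t * s t)%:E)%E.
    by have [_ _ HYn] := HY n; exact: HYn.
  exact: (@doob_running_max _ _ _ P F sF Fm Fmono Y (fun t => h t / s t) s p q n0
    mYn Y0 mhs hs0 ins s0 HYA p1 q0 pq).
have est4 : (B <= C1%:E * (((p `^ q)%:E * B) `^ q^-1 * ((q `^ p)%:E * H) `^ p^-1))%E.
  apply: (le_trans est1); apply: lee_wpmul2l; first by rewrite lee_fin.
  apply: (le_trans (hoelder_weighted P mXX mYY mw ms XX0 YY0 w0'
    (fun t => ltW (s0 t)) q0 p0 qp)).
  apply: lee_pmul; [exact: poweR_ge0|exact: poweR_ge0| |].
  - apply: gt0_ler_poweR; [|rewrite in_itv/= leey andbT..|exact: est2].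
    + by rewrite invr_ge0; exact: ltW.
    + by apply: integral_ge0 => t _; rewrite lee_fin mulr_ge0 ?powR_ge0.
    + by apply: mule_ge0; [rewrite lee_fin; exact: powR_ge0|exact: B0].
  - apply: gt0_ler_poweR; [|rewrite in_itv/= leey andbT..|exact: est3].
    + by rewrite invr_ge0; exact: ltW.
    + apply: integral_ge0 => t _; rewrite lee_fin.
      by apply: mulr_ge0 (powR_ge0 _ _) _; exact: ltW.
    + by apply: mule_ge0; [rewrite lee_fin; exact: powR_ge0|exact: H0].
have Hfin : (H < +oo)%E by exact: hfin.
clear est1 est2 est3; clearbody B H C1.
have BE : B = (fine B)%:E by apply/esym/fineK; rewrite (ge0_fin_numE B0); exact: Bfin.
have HE : H = (fine H)%:E by apply/esym/fineK; rewrite (ge0_fin_numE H0); exact: Hfin.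
move: est4 B0 H0; rewrite BE HE -!EFinM !lee_fin => est4 B0 H0.
apply: (selfbound_powR _ H0 B0 p0 q0 pq).
  by apply: mulr_ge0 => //; apply: mulr_ge0; exact: ltW.
(* [(p^q)^(1/q)] and [(q^p)^(1/p)] reduce to [p] and [q]. *)
apply: (le_trans est4); rewrite !powRM ?powR_ge0// -!powRrM.
rewrite !mulfV ?gt_eqF// !powRr1 ?(ltW p0) ?(ltW q0)//.
by rewrite le_eqVlt; apply/orP; left; apply/eqP; ring.
Qed.

End SparseSums.

(** * From finite blocks of levels to the whole operator *)

Section Limits.
Context {R : realType}.

Lemma ler_sum_widen (g : nat -> R) m n : (forall i, 0 <= g i) -> (m <= n)%N ->
  \sum_(i < m) g i <= \sum_(i < n) g i.
Proof.
move=> g0 mn; rewrite -!(big_mkord xpredT) (big_cat_nat _ mn)//= lerDl.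
exact: sumr_ge0.
Qed.

Lemma ler_square_sum (g : nat -> nat -> R) m n : (forall i j, 0 <= g i j) -> (m <= n)%N ->
  \sum_(k : 'I_m * 'I_m) g k.1 k.2 <= \sum_(k : 'I_n * 'I_n) g k.1 k.2.
Proof.
move=> g0 mn.
rewrite -(pair_bigA _ (fun (i j : 'I_m) => g i j))/=.
rewrite -(pair_bigA _ (fun (i j : 'I_n) => g i j))/=.
apply: (@le_trans _ _ (\sum_(i < m) \sum_(j < n) g i j)).
  by apply: ler_sum => i _; exact: ler_sum_widen.
apply: (ler_sum_widen (g := fun i => \sum_(j < n) g i j)) => // i.
exact: sumr_ge0.
Qed.

(** At a given point stage [i] has its own level [m i]. The side of the square is at least [N] and
    exceeds each of the first [N] values of [m]. *)
Lemma ler_diagonal_square_sum (g : nat -> nat -> R) (s : nat -> R) (m : nat -> nat) N :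
  (forall i j, 0 <= g i j) -> (forall i, s i <= g i (m i)) ->
  exists n, \sum_(i < N) s i <= \sum_(k : 'I_n * 'I_n) g k.1 k.2.
Proof.
move=> g0 sg; pose n := (N + \sum_(i < N) (m i).+1)%N; exists n.
rewrite -(pair_bigA _ (fun (i j : 'I_n) => g i j))/=.
apply: (@le_trans _ _ (\sum_(i < N) \sum_(j < n) g i j)); last first.
  apply: (ler_sum_widen (g := fun i => \sum_(j < n) g i j)); last exact: leq_addr.
  by move=> i; exact: sumr_ge0.
apply: ler_sum => i _; apply: (le_trans (sg i)).
have mn : (m i < n)%N.
  by rewrite /n (bigD1 i)//= addnC -addnA ltnS -?addSn leq_addr.
by rewrite (bigD1 (Ordinal mn))//= lerDl; exact: sumr_ge0.
Qed.

Context {d : measure_display} {T : measurableType d}.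
Variable mu : {measure set T -> \bar R}.

(** The comparison function is the measurable monotone limit [V] of [U^p w]; stating domination
    through all bounds [c] avoids a possibly infinite supremum of [U]. *)
Lemma integral_upper_envelope (U : nat -> T -> R) (w : T -> R) (p : R)
    (phi : T -> \bar R) (B : \bar R) : 0 < p ->
  (forall n, measurable_fun setT (U n)) -> (forall n x, 0 <= U n x) ->
  (forall m n x, (m <= n)%N -> U m x <= U n x) ->
  measurable_fun setT w -> (forall x, 0 < w x) ->
  {ae mu, forall x, forall c : R, (forall n, U n x <= c) -> (`|phi x| <= c%:E)%E} ->
  (forall n, \int[mu]_x (U n x `^ p * w x)%:E <= B)%E ->
  (\int[mu]_x (`|phi x| `^ p * (w x)%:E) <= B)%E.
Proof.
move=> p0 mU U0 Und mw w0 phiU UB.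
pose g n x := (U n x `^ p * w x)%:E.
have g_nd x : nondecreasing_seq (g ^~ x).
  move=> a b ab; rewrite lee_fin ler_wpM2r ?(ltW (w0 x))//.
  by rewrite ge0_ler_powR ?nnegrE ?(ltW p0)//; exact: Und.
have g_cvg x := ereal_nondecreasing_cvgn (g_nd x).
have mg n : measurable_fun setT (g n).
  by apply/measurable_EFinP; apply: measurable_funM => //; exact: measurable_fun_powR.
have g0 n x : (0 <= g n x)%E by rewrite lee_fin mulr_ge0 ?powR_ge0// ltW.
pose V x := limn (g ^~ x).
have VE x : V x = ereal_sup (range (g ^~ x)) by exact/cvg_lim/g_cvg.
have Vge n x : (g n x <= V x)%E by rewrite VE; apply: ereal_sup_ubound; exists n.
have cv : (fun n => \int[mu]_x g n x)%E @ \oo --> (\int[mu]_x V x)%E.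
  by apply: cvg_monotone_convergence => // x _; exact: g_nd.
apply: (@le_trans _ _ (\int[mu]_x V x)%E); last first.
  rewrite -(cvg_lim _ cv)//; apply: lime_le; last exact: nearW.
  by apply/cvg_ex; eexists; exact: cv.
apply: ae_le_ge0_integral.
- by move=> x; rewrite mule_ge0 ?poweR_ge0// lee_fin ltW.
- by move=> x; exact: le_trans (g0 0%N x) (Vge 0%N x).
- apply: (emeasurable_fun_cvg g) => // x _.
  by rewrite VE; exact: g_cvg.
- apply: filterS phiU => x phiU.
  have V0 : (0 <= V x)%E by exact: le_trans (g0 0%N x) (Vge 0%N x).
  have gV n : (g n x <= V x)%E by exact: Vge.
  move: V0 gV; case: (V x) => [r| |//]; last by move=> _ _; exact: leey.
  rewrite lee_fin => r0 gr.
  (* A finite limit [r] yields this common bound, which is the [c] fed to the hypothesis on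
     [phi]. *)
  have Ur n : U n x <= (r / w x) `^ p^-1.
    have := gr n; rewrite lee_fin -ler_pdivlMr// => H.
    have -> : U n x = (U n x `^ p) `^ p^-1.
      by rewrite -powRrM mulfV ?gt_eqF// powRr1.
    by rewrite ge0_ler_powR ?nnegrE ?powR_ge0 ?invr_ge0 ?(ltW p0)// divr_ge0// ltW.
  have rw0 : 0 <= r / w x by rewrite divr_ge0// ltW.
  have := phiU _ Ur; case: (phi x) => [s| |]//=.
  rewrite lee_fin => sr; rewrite -EFinM lee_fin -ler_pdivlMr//.
  have := ge0_ler_powR (ltW p0) _ _ sr; rewrite !nnegrE normr_ge0 powR_ge0.
  by move=> /(_ isT isT); rewrite -powRrM mulVf ?gt_eqF// powRr1.
Qed.

End Limits.

(** * Levels of the sparse family inside the base filtration *)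

Section SparseLevels.
Context {d : measure_display} {T : measurableType d} {R : realType}.
Variables (P : probability T R) (F : nat -> set (set T)) (tau : nat -> T -> option nat).
Hypothesis sF : forall n, sigma_algebra setT (F n).
Hypothesis Fm : forall n, F n `<=` measurable.
Hypothesis Fmono : forall m n, (m <= n)%N -> F m `<=` F n.

(** One existing version rules out the default value, and any two versions agree almost
    everywhere. *)
Lemma Eat_version n (f g : T -> R) : version P (F n) f g ->
  {ae P, forall x, Eat P F n f x = g x}.
Proof.
move=> [mg g0 ig Eg]; rewrite /Eat /cond_exp.
case: xgetP => [u _ [mu iu Eu]|nu].
  have muG : measurable_fun (setT : set (g_sigma_algebraType (F n))) u.
    by move=> _ B mB; apply/(sub_measurableE (sF n)); exact: mu.
  have le1 : {ae P, forall x, u x <= g x}.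
    by apply: (ae_le_of_sub_integral (sF n) (@Fm n)) => // A FA; rewrite Eg// -Eu.
  have le2 : {ae P, forall x, g x <= u x}.
    by apply: (ae_le_of_sub_integral (sF n) (@Fm n)) => // A FA; rewrite Eg// -Eu.
  by apply: filterS2 le1 le2 => x ? ?; apply/eqP; rewrite eq_le; apply/andP.
exfalso; apply: (nu g); split => //= B mB.
by apply/(sub_measurableE (sF n)); exact: mg.
Qed.

Hypothesis lt : local_times P F tau.

(* [level] is only meaningful as long as no [Eset] of probability zero has
   been met; beyond that point the level sets are empty. *)
Definition stop_level (i n : nat) : set T :=
  [set x | shifted_space P F tau i /\ level tau i.+1 n x].

Lemma filtration_stop_level i n : F n (stop_level i n).
Proof.
have [S|nS] := pselect (shifted_space P F tau i).
  have -> : stop_level i n = level tau i.+1 n by apply/seteqP; split => x //= -[].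
  exact: (shifted_levelS sF S).
have -> : stop_level i n = set0 by apply/seteqP; split => x //= -[].
by have [] := sF n.
Qed.

Lemma stop_level_Eset i n : stop_level i n `<=` Eset P F tau i.
Proof.
by move=> x [S Lx]; rewrite Eset_reached// /reached; move: Lx; rewrite /level/= => ->.
Qed.

Lemma stop_level_inj i n m x : stop_level i n x -> stop_level i m x -> n = m.
Proof. by move=> [_ +] [_]; rewrite /level/= => -> []. Qed.

Lemma ae_stop_level : {ae P, forall x, forall i, Eset P F tau i x ->
  exists n, stop_level i n x}.
Proof.
apply/ae_foralln => i.
case: (spaces_dichotomy sF Fm Fmono lt i) => [S|[mE E0 _]].
  apply: aeW => x; rewrite Eset_reached//.
  by rewrite /reached/=; case E: (obind _ _) => [k|]// _; exists k.
exists (Eset P F tau i); split => // x /= H; apply: contrapT => Ex.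
by apply: H => /Ex.
Qed.

Lemma measurable_Sset i : measurable (Sset P F tau i).
Proof. by apply: measurableD; exact: measurable_Eset. Qed.

Lemma Sset_inj i j x : Sset P F tau i x -> Sset P F tau j x -> i = j.
Proof.
have sub a b : (a <= b)%N -> Eset P F tau b `<=` Eset P F tau a.
  elim: b => [|b IH]; first by rewrite leqn0 => /eqP ->.
  rewrite leq_eqVlt => /orP[/eqP->//|/IH]; apply: subset_trans.
  exact: Eset_subset.
have aux a b : (a < b)%N -> Sset P F tau a x -> Sset P F tau b x -> False.
  by move=> ab [_ nE] [Eb _]; apply: nE; exact: sub Eb.
by move=> Si Sj; case: (ltngtP i j) => // H; exfalso;
  [exact: aux H Si Sj|exact: aux H Sj Si].
Qed.

Lemma Estop_version i n (h g : T -> R) : (forall x, 0 <= h x) -> measurable_fun setT h ->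
  version P (F n) h g ->
  {ae P, forall x, stop_level i n x ->
    0 <= Estop P F tau i h x /\ Estop P F tau i h x <= g x}.
Proof.
move=> h0 mh [mg g0 ig Eg]; have [S|nS] := pselect (shifted_space P F tau i); last first.
  by apply: aeW => x [].
have H1 := Estop_ge0 sF Fm Fmono n S h0 mh.
have H2 := Estop_le_condexp sF Fm Fmono S h0 mh ig mg g0 Eg.
by apply: filterS2 H1 H2 => x H1 H2 [_ Lx]; split; [exact: H1|exact: H2].
Qed.

(** At almost every point a stage that contains it does so in one level, whose [y] bounds the term;
    each partial sum is thus below a finite square of level terms. *)
Lemma sparse_op_bound (h : T -> R) (y : nat -> T -> R) :
  (forall x, 0 <= h x) -> measurable_fun setT h ->
  (forall n, version P (F n) h (y n)) ->
  {ae P, forall x, forall c : R,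
    (forall n, \sum_(k : 'I_n * 'I_n) \1_(stop_level k.1 k.2) x * y k.2 x <= c) ->
    (`| \sum_(0 <= i <oo) (Estop P F tau i h x * \1_(Eset P F tau i) x)%:E | <= c%:E)%E}.
Proof.
move=> h0 mh vy.
have H1 : {ae P, forall x, forall i n, stop_level i n x ->
    0 <= Estop P F tau i h x /\ Estop P F tau i h x <= y n x}.
  by apply/ae_foralln => i; apply/ae_foralln => n; exact: Estop_version.
apply: filterS2 H1 ae_stop_level => x H1 H2 c Uc.
have y0 n : 0 <= y n x by have [_ + _ _] := vy n; exact.
pose s i := Estop P F tau i h x * \1_(Eset P F tau i) x.
have /choice[m Hm] : forall i, exists m,
    0 <= s i /\ s i <= \1_(stop_level i m) x * y m x.
  move=> i; have [Ex|Ex] := pselect (Eset P F tau i x).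
    have [m Dm] := H2 i Ex; exists m; have [u0 uy] := H1 i m Dm.
    by rewrite /s !indicE !mem_set// mulr1 mul1r.
  by exists 0%N; rewrite /s indicE memNset// mulr0 mulr_ge0.
have s0 i : 0 <= s i by have [] := Hm i.
have bnd N : \sum_(i < N) s i <= c.
  have [||n Hn] := @ler_diagonal_square_sum R
    (fun i j => \1_(stop_level i j) x * y j x) s m N.
  - by move=> i j; rewrite mulr_ge0.
  - by move=> i; have [] := Hm i.
  - exact: le_trans Hn (Uc n).
rewrite gee0_abs; last by apply: nneseries_ge0 => i _ _; rewrite lee_fin s0.
apply: lime_le.
  by apply: is_cvg_nneseries => i _ _; rewrite lee_fin s0.
by apply: nearW => N; rewrite sumEFin lee_fin big_mkord.
Qed.

End SparseLevels.

(** * The mixed constant and the theorem *)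

(** The exponents [al] and [1 - al] recombine the powers of [b] to [b] and reduce that of [a] to 1;
    [q >= 2] keeps both nonnegative, so both powers are monotone. *)
Lemma interpolated_bound {R : realType} (q r a b c : R) (A1 A2 : \bar R) : 2 <= q ->
  0 <= a -> 0 < b -> 0 <= c ->
  ((b * a `^ (q - 1))%:E <= A1)%E -> ((b * c `^ (r - 1))%:E <= A2)%E ->
  ((a * b * c `^ ((r - 1) * (1 - (q - 1)^-1)))%:E <=
    A1 `^ (q - 1)^-1 * A2 `^ (1 - (q - 1)^-1))%E.
Proof.
move=> q2 a0 b0 c0 H1 H2; set al := (q - 1)^-1.
have q10 : 0 < q - 1 by lra.
have al0 : 0 <= al by rewrite invr_ge0 ltW.
have al1 : 0 <= 1 - al by rewrite subr_ge0 invf_le1//; lra.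
have x0 : 0 <= b * a `^ (q - 1) by rewrite mulr_ge0 ?powR_ge0// ltW.
have y0 : 0 <= b * c `^ (r - 1) by rewrite mulr_ge0 ?powR_ge0// ltW.
have -> : a * b * c `^ ((r - 1) * (1 - al)) =
    (b * a `^ (q - 1)) `^ al * (b * c `^ (r - 1)) `^ (1 - al).
  rewrite !powRM ?powR_ge0 ?(ltW b0)// -!powRrM mulfV ?gt_eqF// powRr1//.
  have {1}-> : b = b `^ al * b `^ (1 - al); last by ring.
  rewrite -powRD; first by rewrite subrKC powRr1// ltW.
  by rewrite [b == 0]gt_eqF// implybT.
have mono (x g : R) (A : \bar R) : 0 <= g -> 0 <= x -> (x%:E <= A)%E ->
    ((x `^ g)%:E <= A `^ g)%E.
  move=> g0 {}x0 xA; rewrite -poweR_EFin; apply: gt0_ler_poweR => //.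
    by rewrite in_itv/= leey andbT lee_fin.
  by rewrite in_itv/= leey andbT (le_trans _ xA)// lee_fin.
rewrite EFinM; apply: lee_pmul.
- by rewrite lee_fin powR_ge0.
- by rewrite lee_fin powR_ge0.
- exact: mono.
- exact: mono.
Qed.

Section MixedConstant.
Context {d : measure_display} {T : measurableType d} {R : realType}.
Variables (P : probability T R) (F : nat -> set (set T)).
Hypothesis sF : forall n, sigma_algebra setT (F n).
Hypothesis Fm : forall n, F n `<=` measurable.

Lemma mixedA_ge0 (q al r be : R) (rho : T -> R) : (0 <= mixedA P F q al r be rho)%E.
Proof.
apply: (@le_trans _ _ (Aconst P F 0 q rho `^ al * Aconst P F 0 r rho `^ be)%E).
  by rewrite mule_ge0// poweR_ge0.
by apply: ereal_sup_ubound; exists 0%N.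
Qed.

Lemma Aconst_version n (q : R) (rho b a : T -> R) :
  version P (F n) rho b -> version P (F n) (fun y => rho y `^ (- (q - 1)^-1)) a ->
  {ae P, forall x, ((b x * a x `^ (q - 1))%:E <= Aconst P F n q rho)%E}.
Proof.
move=> vb va.
have Eb := Eat_version sF Fm vb; have Ea := Eat_version sF Fm va.
have [_ b0 _ _] := vb.
have PT : (0 < P setT)%E by rewrite probability_setT lte01.
(* The norm at infinity unfolds to an essential supremum only when the total mass is positive. *)
rewrite /Aconst Lnorm.unlock/= PT.
set f := (X in ess_sup P (abse \o X)).
have H : {ae P, forall x, (`|f x| <= ess_sup P (abse \o f))%E}.
  exact: (ess_sup_ge P (abse \o f)).
apply: filterS3 Eb Ea H => x Ebx Eax; apply: le_trans.
by rewrite /f Ebx Eax abse_EFin ger0_norm// mulr_ge0// powR_ge0.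
Qed.

Lemma mixedA_version n (q r : R) (rho a b c : T -> R) : 2 <= q ->
  version P (F n) rho b -> (forall x, 0 < b x) ->
  version P (F n) (fun y => rho y `^ (- (q - 1)^-1)) a ->
  version P (F n) (fun y => rho y `^ (- (r - 1)^-1)) c ->
  {ae P, forall x, ((a x * b x * c x `^ ((r - 1) * (1 - (q - 1)^-1)))%:E <=
    mixedA P F q (q - 1)^-1 r (1 - (q - 1)^-1) rho)%E}.
Proof.
move=> q2 vb b0 va vc.
have [_ a0 _ _] := va; have [_ c0 _ _] := vc.
apply: filterS2 (Aconst_version vb va) (Aconst_version vb vc) => x H1 H2.
apply: (le_trans (interpolated_bound q2 (a0 x) (b0 x) (c0 x) H1 H2)).
by apply: ereal_sup_ubound; exists n.
Qed.

End MixedConstant.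

Lemma powR_le1D {R : realType} (x e : R) : 0 < x -> 0 <= e -> e <= 1 -> x `^ e <= 1 + x.
Proof.
move=> x0 e0 e1; have [x1|/ltW x1] := leP x 1.
  apply: (@le_trans _ _ 1); last by rewrite lerDl ltW.
  have := ge0_ler_powR e0 _ _ x1; rewrite !nnegrE (ltW x0) ler01 => /(_ isT isT).
  by rewrite powR1.
by apply: (le_trans (ler1_powR x1 e1)); rewrite lerDr.
Qed.

(** Domination by [1 + w]. This gives the integrability of [u], hence its conditional
    expectations. *)
Lemma integrable_powR_le1 {d : measure_display} {T : measurableType d} {R : realType}
    (P : probability T R) (w : T -> R) (e : R) :
  (forall x, 0 < w x) -> P.-integrable setT (EFin \o w) -> 0 <= e -> e <= 1 ->
  P.-integrable setT (EFin \o (fun x => w x `^ e)).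
Proof.
move=> w0 iw e0 e1.
have mw : measurable_fun setT w by apply/measurable_EFinP; exact: measurable_int iw.
have i1 : P.-integrable setT (EFin \o (cst 1 : T -> R)).
  exact: finite_measure_integrable_cst.
apply: (le_integrable _ _ _ (integrableD measurableT i1 iw)) => //.
  by apply/measurable_EFinP; exact: measurable_fun_powR.
move=> x _ /=; rewrite lee_fin !ger0_norm ?powR_ge0//; first exact: powR_le1D.
by rewrite addr_ge0// ltW.
Qed.

(** As [p' - 1 = 1/(p - 1)], [kappa] is [(r - 1)(2 - p)] and both sides of the last identity equal
    [s^(2-p)], split as Hoelder with [p'] on [w] and [p] on [s] requires. *)
Lemma sigma_powR {R : realType} (p r x : R) (p' := p / (p - 1))
    (kappa := (r - 1) * (1 - (p' - 1)^-1)) (s := x `^ (- (p - 1)^-1)) :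
  1 < p -> 1 < r -> 0 < x ->
  [/\ s `^ (- (p' - 1)^-1) = x, s `^ (1 - p) = x,
      s `^ (- (r - 1)^-1) = x `^ ((p - 1) * (r - 1))^-1 &
      (s `^ (- (r - 1)^-1)) `^ (- kappa) = x `^ p'^-1 * s `^ p^-1].
Proof.
move=> p1 r1 x0.
have p0 : p != 0 by rewrite gt_eqF//; lra.
have p10 : p - 1 != 0 by rewrite gt_eqF//; lra.
have r10 : r - 1 != 0 by rewrite gt_eqF//; lra.
have p'E : p' - 1 = (p - 1)^-1 by rewrite /p'; field.
rewrite /kappa p'E invrK /s -!powRrM; split.
- by rewrite mulrNN mulVf// powRr1// ltW.
- rewrite -[1 - p]opprB mulrNN mulVf// powRr1//; exact: ltW.
- by rewrite mulrNN invfM.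
- rewrite -powRD; last by rewrite [x == 0]gt_eqF// implybT.
  by congr (_ `^ _); rewrite /p'; field; rewrite p0 p10 r10.
Qed.

Theorem corollary1p6 (R : realType) (p r K : R) (p' := p / (p - 1))
    (hp1 : 1 < p) (hp2 : p <= 2) (hp' : 2 <= p') (hr : p' <= r) (hK : 1 <= K) :
  exists2 C : R, 0 < C &
    forall (d : measure_display) (T : measurableType d) (P : probability T R)
      (F : nat -> set (set T)) (w : T -> R) (sigma := fun x => w x `^ (- (p - 1)^-1))
      (tau : nat -> T -> option nat),
    filtered_probability_space P F ->
    weight P w ->
    P.-integrable setT (EFin \o sigma) ->
    (mixedA P F p' (p' - 1)^-1 r (1 - (p' - 1)^-1) sigma < +oo)%E ->
    conditionally_sparse P F tau K ->
    forall f : T -> R, in_wLp P p w f ->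
      (wnorm P p w (sparse_op P F tau f) <=
       C%:E * mixedA P F p' (p' - 1)^-1 r (1 - (p' - 1)^-1) sigma
         * wnorm P p w (EFin \o f))%E.
Proof.
have p0 : 0 < p by lra.
have q0 : 0 < p' by lra.
have q1 : 1 < p' by lra.
have r1 : 1 < r by lra.
have K0 : 0 < K by lra.
have p10 : p - 1 != 0 by rewrite gt_eqF//; lra.
have pq : p^-1 + p'^-1 = 1 by rewrite /p'; field; rewrite p10 gt_eqF.
have p'E : p' - 1 = (p - 1)^-1 by rewrite /p'; field.
pose kappa := (r - 1) * (1 - (p' - 1)^-1).
have k0 : 0 <= kappa.
  by rewrite /kappa p'E invrK mulr_ge0//; lra.
(* The constant of [sparse_sum_estimate] without its factor [M]. *)
exists (2 * K * (2 * K) `^ kappa * (p * p')).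
  by apply: mulr_gt0; apply: mulr_gt0 => //; [exact: mulr_gt0|apply: powR_gt0; exact: mulr_gt0].
move=> d T P F w sigma tau [_ sFm Fmono _ _] [w0 iw] isig mixfin [_ lt sp] f [mf ffin].
have sF n : sigma_algebra setT (F n) by have [] := sFm n.
have Fm n : F n `<=` measurable by have [] := sFm n.
have mw : measurable_fun setT w by apply/measurable_EFinP; exact: measurable_int iw.
have msig : measurable_fun setT sigma.
  by apply/measurable_EFinP; exact: measurable_int isig.
have sig0 x : 0 < sigma x by exact: powR_gt0.
pose u x := sigma x `^ (- (r - 1)^-1).
have u0 x : 0 < u x by exact: powR_gt0.
have iu : P.-integrable setT (EFin \o u).
  have -> : u = (fun x => w x `^ ((p - 1) * (r - 1))^-1).
    by apply/funext => x; have [_ _ + _] := sigma_powR hp1 r1 (w0 x).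
  (* From [p' <= r] and [(p - 1)(p' - 1) = 1]: [u] is a power of [w] with exponent at most 1. *)
  have pr : 1 <= (p - 1) * (r - 1).
    have E1 : (p - 1) * (p' - 1) = 1 by rewrite p'E mulfV.
    by rewrite -[X in X <= _]E1 ler_wpM2l; lra.
  apply: integrable_powR_le1 => //; first by rewrite invr_ge0; lra.
  by rewrite invf_le1//; lra.
pose v x := u x `^ (- kappa).
have vE x : v x = w x `^ p'^-1 * sigma x `^ p^-1.
  by have [] := sigma_powR hp1 r1 (w0 x).
have sw x : sigma x `^ (1 - p) = w x by have [] := sigma_powR hp1 r1 (w0 x).
have sqE : (fun y => sigma y `^ (- (p' - 1)^-1)) = w.
  by apply/funext => x; have [] := sigma_powR hp1 r1 (w0 x).
set A := mixedA _ _ _ _ _ _ _ in mixfin *.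
have A0 : (0 <= A)%E by exact: mixedA_ge0.
pose M := fine A.
have AE : A = M%:E by apply/esym/fineK; rewrite (ge0_fin_numE A0).
have M0 : 0 <= M by exact: fine_ge0.
pose h x := `|f x|.
have h0 x : 0 <= h x by exact: normr_ge0.
have mh : measurable_fun setT h by exact: measurableT_comp.
pose H := (\int[P]_x (h x `^ p * w x)%:E)%E.
have fE : wnorm P p w (EFin \o f) = (H `^ p^-1)%E by [].
have H0 : (0 <= H)%E.
  by apply: integral_ge0 => x _; rewrite lee_fin mulr_ge0 ?powR_ge0// ltW.
have Hfin : (H < +oo)%E.
  by move: ffin; rewrite fE; apply: lty_poweRy; rewrite invr_eq0 gt_eqF.
(* Hoelder with [w^(1/p) sigma^(1/p') = 1] puts [f] in [L^1]. *)
have ih : P.-integrable setT (EFin \o h).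
  apply: integrable_ge0 => //.
  have := @hoelder_weighted R _ _ P h (cst 1) w sigma p p' mh (measurable_cst _) mw msig
    h0 (fun=> ler01) (fun x => ltW (w0 x)) (fun x => ltW (sig0 x)) p0 q0 pq.
  have -> : (\int[P]_x (h x * cst 1 x * (w x `^ p^-1 * sigma x `^ p'^-1))%:E =
     \int[P]_x (h x)%:E)%E.
    apply: eq_integral => x _; congr (_%:E); rewrite /= mulr1.
    have -> : w x `^ p^-1 * sigma x `^ p'^-1 = 1; last by rewrite mulr1.
    rewrite -powRrM -powRD; last by rewrite [w x == 0]gt_eqF// implybT.
    have -> : p^-1 + - (p - 1)^-1 / p' = 0; last by rewrite powRr0.
    by rewrite /p'; field; rewrite p10 gt_eqF.
  move=> /le_lt_trans; apply; apply: lte_mul_pinfty.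
  - exact: poweR_ge0.
  - by rewrite ge0_fin_numE ?poweR_ge0//; exact: poweR_lty.
  - apply: poweR_lty.
    have -> : (\int[P]_x (cst 1 x `^ p' * sigma x)%:E = \int[P]_x (sigma x)%:E)%E.
      by apply: eq_integral => x _; rewrite powR1 mul1r.
    by have := integrable_fin_num measurableT isig; rewrite /= ltey_eq => ->.
have /choice[y vy] : forall n, exists y, version P (F n) h y.
  by move=> n; exact: (exists_version (sF n) (@Fm n) h0 ih).
have y0 n x : 0 <= y n x by have [_ + _ _] := vy n; exact.
pose D := stop_level P F tau; pose S := Sset P F tau.
have mS i : measurable (S i) by exact: measurable_Sset.
have dis t i n j m : (D i n `&` S i) t -> (D j m `&` S j) t -> i = j /\ n = m.
  move=> [Di Si] [Dj Sj]; have ij := Sset_inj lt Si Sj; split => //.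
  by apply: (stop_level_inj Di); rewrite ij.
(* On the level the local conditional expectation is at most [e], so the sparsity inequality passes
   to [e]. *)
have sparse i n e : version P (F n) (\1_(S i)) e ->
    {ae P, forall t, D i n t -> 1 <= K * e t}.
  move=> ve.
  have E1 := @Estop_version _ _ _ P F tau sF Fm Fmono i n (\1_(S i)) e
    (fun t => ler0n _ _) (measurable_indic (mS i)) ve.
  apply: filterS2 E1 (sp i) => t E1 spi Dt.
  move: spi; rewrite indicE mem_set ?mulr1; last exact: stop_level_Eset Dt.
  move=> /le_trans; apply; rewrite ler_pM2l//.
  by have [] := E1 Dt.
have mixed n a b c : version P (F n) w a -> version P (F n) sigma b ->
    version P (F n) u c -> {ae P, forall t, a t * b t * c t `^ kappa <= M}.
  move=> va vb vc.
  (* The interpolation requires a positive [b], so the given version is exchanged for one that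
     agrees with it almost everywhere. *)
  have [b' vb' b'0] := exists_pos_version (sF n) (@Fm n) sig0 isig.
  have va' : version P (F n) (fun y => sigma y `^ (- (p' - 1)^-1)) a by rewrite sqE.
  have bb' := version_ae_eq (sF n) (@Fm n) vb vb'.
  apply: filterS2 bb' (mixedA_version sF Fm hp' vb' b'0 va' vc) => t ->.
  by rewrite -/A AE lee_fin.
pose U n x := \sum_(k : 'I_n * 'I_n) \1_(D k.1 k.2) x * y k.2 x.
have est n := @sparse_sum_estimate _ _ _ P F sF Fm Fmono p p' K M kappa w sigma u v h D S y n
  hp1 q1 pq hK M0 k0 w0 iw sig0 isig u0 iu (fun=> erefl) vE sw
  (@filtration_stop_level _ _ _ P F tau sF) mS dis sparse mixed h0 mh vy Hfin.
have main : (\int[P]_x (`|sparse_op P F tau f x| `^ p * (w x)%:E) <=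
    ((M * (2 * K) * (2 * K) `^ kappa * (p * p')) `^ p)%:E * H)%E.
  apply: (@integral_upper_envelope _ _ _ P U w p) => //.
  - move=> n; apply: measurable_sum => k; apply: measurable_funM.
      by apply: measurable_indic; apply: (@Fm k.2); exact: filtration_stop_level.
    exact: (version_measurable (sF k.2) (@Fm k.2) (vy _)).
  - by move=> n x; apply: sumr_ge0 => k _; rewrite mulr_ge0.
  - move=> m n x mn.
    apply: (@ler_square_sum R (fun i j => \1_(D i j) x * y j x)) => // i j.
    by rewrite mulr_ge0.
  - exact: (sparse_op_bound sF Fm Fmono lt h0 mh vy).
have C0 : 0 <= M * (2 * K) * (2 * K) `^ kappa * (p * p').
  apply: mulr_ge0; last by apply: mulr_ge0; exact: ltW.
  apply: mulr_ge0 (powR_ge0 _ _); apply: mulr_ge0 => //.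
  by apply: mulr_ge0 => //; exact: ltW.
rewrite fE AE; apply: (@le_trans _ _
   ((((M * (2 * K) * (2 * K) `^ kappa * (p * p')) `^ p)%:E * H) `^ p^-1)%E).
  apply: gt0_ler_poweR; [|rewrite in_itv/= leey andbT..|exact: main].
  - by rewrite invr_ge0 ltW.
  - apply: integral_ge0 => x _; apply: mule_ge0; first exact: poweR_ge0.
    by rewrite lee_fin ltW.
  - by apply: mule_ge0; [rewrite lee_fin; exact: powR_ge0|exact: H0].
rewrite poweRM; [|by rewrite lee_fin; exact: powR_ge0|exact: H0].
rewrite poweR_EFin -powRrM mulfV ?gt_eqF// powRr1// -EFinM.
rewrite le_eqVlt; apply/orP; left; apply/eqP; congr (_%:E * _)%E; ring.
Qed.
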